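(* Let $H$ be a pointed Hopf algebra over a field $\Bbbk$. If $H$ is right or left Noetherian, then every Hopf subalgebra of $H$ is affine; equivalently, every ascending chain of Hopf subalgebras of $H$ stabilizes.
   Context: A Hopf algebra over $\Bbbk$ is pointed if its coradical (the sum of its simple subcoalgebras) is the span of its group-like elements. A $\Bbbk$-algebra is affine if it is finitely generated as a $\Bbbk$-algebra. *)

(* Defs.v *)
From HB Require Import structures.
From mathcomp Require Import all_boot all_algebra.
From mathcomp Require Import boolp classical_sets.

Set Implicit Arguments.
Unset Strict Implicit.
Unset Printing Implicit Defensive.

Import GRing.Theory.

Local Open Scope ring_scope.
Local Open Scope classical_set_scope.
Local Open Scope quotient_scope.

Reserved Notation "V ⊗ W" (at level 40, left associativity).
Reserved Notation "v '⊗t' w" (at level 40, left associativity).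

(* V ⊗ W is the set of formal sums of pairs (v, w) modulo the congruence    *)
(* generated by commutativity and bilinearity (so -(v, w) is (-v, w)).      *)

Inductive tens_eq (k : fieldType) (V W : lmodType k) :
    seq (V * W) -> seq (V * W) -> Prop :=
| tens_refl s : tens_eq s s
| tens_sym s t : tens_eq s t -> tens_eq t s
| tens_trans t s u : tens_eq s t -> tens_eq t u -> tens_eq s u
| tens_cat s1 s2 t1 t2 :
    tens_eq s1 t1 -> tens_eq s2 t2 -> tens_eq (s1 ++ s2) (t1 ++ t2)
| tens_catC s t : tens_eq (s ++ t) (t ++ s)
| tens_Dl v v' w : tens_eq [:: (v + v', w)] [:: (v, w); (v', w)]
| tens_Dr v w w' : tens_eq [:: (v, w + w')] [:: (v, w); (v, w')]
| tens_Z (a : k) v w : tens_eq [:: (a *: v, w)] [:: (v, a *: w)]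
| tens_0 w : tens_eq [:: (0, w)] [::].

Section TensorProduct.
Variables (k : fieldType) (V W : lmodType k).
Implicit Types (s t : seq (V * W)).

Definition tens_eqb s t : bool := `[< tens_eq s t >].

Lemma tens_eqb_refl : reflexive tens_eqb.
Proof. by move=> s; apply/asboolP; apply: tens_refl. Qed.
Lemma tens_eqb_sym : symmetric tens_eqb.
Proof.
by move=> s t; apply/asboolP/asboolP => h; apply: tens_sym.
Qed.
Lemma tens_eqb_trans : transitive tens_eqb.
Proof.
move=> t s u /asboolP st /asboolP tu; apply/asboolP; exact: tens_trans st tu.
Qed.

Canonical tens_equiv := EquivRel tens_eqb tens_eqb_refl tens_eqb_sym tens_eqb_trans.

Definition tensor := {eq_quot tens_equiv}.

HB.instance Definition _ := Choice.on tensor.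
HB.instance Definition _ := EqQuotient.on tensor.

Lemma tens_piP s t : (\pi_tensor s = \pi_tensor t) <-> tens_eq s t.
Proof.
split=> [/eqmodP /asboolP //|h].
by apply/eqmodP; apply/asboolP.
Qed.

Lemma tens_reprP s : tens_eq (repr (\pi_tensor s)) s.
Proof. by apply/tens_piP; rewrite reprK. Qed.

Let opp_pair (p : V * W) := (- p.1, p.2).
Let scale_pair (a : k) (p : V * W) := (a *: p.1, p.2).

Definition tens_zero : tensor := \pi_tensor [::].
Definition tens_add (x y : tensor) : tensor := \pi_tensor (repr x ++ repr y).
Definition tens_opp (x : tensor) : tensor := \pi_tensor (map opp_pair (repr x)).
Definition tens_scale (a : k) (x : tensor) : tensor :=
  \pi_tensor (map (scale_pair a) (repr x)).

Lemma tens_addE s t : tens_add (\pi_tensor s) (\pi_tensor t) = \pi_tensor (s ++ t).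
Proof. by apply/tens_piP; apply: tens_cat; apply: tens_reprP. Qed.

Lemma tens_eq_scale a s t : tens_eq s t ->
  tens_eq (map (scale_pair a) s) (map (scale_pair a) t).
Proof.
elim=> {s t} [s|s t _|t s u _ st _|s1 s2 t1 t2 _ h1 _ h2|s t|v v' w|v w w'|b v w|w].
- exact: tens_refl.
- exact: tens_sym.
- exact: tens_trans st.
- by rewrite !map_cat; apply: tens_cat.
- by rewrite !map_cat; apply: tens_catC.
- by rewrite /= /scale_pair /= scalerDr; apply: tens_Dl.
- by rewrite /= /scale_pair /=; apply: tens_Dr.
- by rewrite /= /scale_pair /= scalerA mulrC -scalerA; apply: tens_Z.
- by rewrite /= /scale_pair /= scaler0; apply: tens_0.
Qed.

Lemma tens_scaleE a s : tens_scale a (\pi_tensor s) = \pi_tensor (map (scale_pair a) s).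
Proof. by apply/tens_piP; apply: tens_eq_scale; apply: tens_reprP. Qed.

Lemma tens_oppE x : tens_opp x = tens_scale (-1) x.
Proof.
congr (\pi _); apply: eq_map => p.
by rewrite /opp_pair /scale_pair scaleN1r.
Qed.

Lemma tens_addA : associative tens_add.
Proof.
elim/quotW=> x; elim/quotW=> y; elim/quotW=> z.
by rewrite (tens_addE y z) (tens_addE x y) !tens_addE catA.
Qed.
Lemma tens_addC : commutative tens_add.
Proof.
move=> x y; rewrite -[x]reprK -[y]reprK !tens_addE.
by apply/tens_piP; apply: tens_catC.
Qed.
Lemma tens_add0 : left_id tens_zero tens_add.
Proof. by move=> x; rewrite -[x]reprK tens_addE. Qed.

Lemma tens_scaleDl x a b :
  tens_scale (a + b) x = tens_add (tens_scale a x) (tens_scale b x).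
Proof.
rewrite -[x]reprK !tens_scaleE tens_addE; apply/tens_piP.
elim: (repr x) => [|p s IHs] /=; first exact: tens_refl.
apply: (@tens_trans _ _ _ (([:: scale_pair a p] ++ [:: scale_pair b p]) ++
   (map (scale_pair a) s ++ map (scale_pair b) s))).
  apply: (@tens_cat _ _ _ [:: _]) IHs.
  by rewrite /scale_pair scalerDl; apply: tens_Dl.
apply: (@tens_cat _ _ _ [:: _] _ [:: _]); first exact: tens_refl.
rewrite -[X in tens_eq X]/([:: scale_pair b p] ++ (_ ++ _)).
rewrite -[X in tens_eq _ X]/(_ ++ ([:: scale_pair b p] ++ _)) !catA.
by apply: tens_cat; [apply: tens_catC | apply: tens_refl].
Qed.

Lemma tens_scale0 x : tens_scale 0 x = tens_zero.
Proof.
rewrite -[x]reprK tens_scaleE; apply/tens_piP.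
elim: (repr x) => [|p s IHs] /=; first exact: tens_refl.
apply: (@tens_cat _ _ _ [:: _] _ [::] [::]) IHs.
by rewrite /scale_pair scale0r; apply: tens_0.
Qed.

Lemma tens_scale1 : left_id 1 tens_scale.
Proof.
move=> x; rewrite -[x]reprK tens_scaleE; congr (\pi _).
by rewrite -[RHS]map_id; apply: eq_map => -[v w]; rewrite /scale_pair scale1r.
Qed.

Lemma tens_addN : left_inverse tens_zero tens_opp tens_add.
Proof.
move=> x; rewrite tens_oppE -[X in tens_add _ X]tens_scale1 -tens_scaleDl.
by rewrite addNr tens_scale0.
Qed.

HB.instance Definition _ := GRing.isZmodule.Build tensor
  tens_addA tens_addC tens_add0 tens_addN.

Lemma tens_scaleA a b x :
  tens_scale a (tens_scale b x) = tens_scale (a * b) x.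
Proof.
elim/quotW: x => s.
rewrite (tens_scaleE b s) (tens_scaleE (a * b) s) tens_scaleE -map_comp.
by congr (\pi _); apply: eq_map => p; rewrite /scale_pair /= scalerA.
Qed.

Lemma tens_scaleDr : right_distributive tens_scale +%R.
Proof.
move=> a x y; elim/quotW: x => s; elim/quotW: y => t.
rewrite /GRing.add /= (tens_addE s t) (tens_scaleE a s) (tens_scaleE a t).
by rewrite tens_addE tens_scaleE map_cat.
Qed.

HB.instance Definition _ := GRing.Zmodule_isLmodule.Build k tensor
  tens_scaleA tens_scale1 tens_scaleDr (fun x a b => tens_scaleDl x a b).

Definition tens (v : V) (w : W) : tensor := \pi_tensor [:: (v, w)].

(* The linear map V ⊗ W -> U induced by f. Junk unless f is bilinear.      *)
Definition tens_lift (U : zmodType) (f : V -> W -> U) (x : tensor) : U :=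
  \sum_(p <- repr x) f p.1 p.2.

End TensorProduct.

Notation "V ⊗ W" := (tensor V W) : type_scope.
Notation "v '⊗t' w" := (tens v w) : ring_scope.

Section TensorTheory.
Variables (k : fieldType) (V W : lmodType k).

Lemma tens_bilinear : bilinear_for *:%R *:%R (@tens k V W).
Proof.
have ZE a v w : a *: (v ⊗t w) = (a *: v) ⊗t w :> V ⊗ W.
  by rewrite /GRing.scale /= tens_scaleE.
split=> [w a v v'|v a w w'] /=; rewrite ZE.
  by rewrite /GRing.add /= tens_addE; apply/tens_piP; apply: tens_Dl.
rewrite /GRing.add /= tens_addE; apply/tens_piP.
apply: tens_trans (tens_Dr _ _ _) _.
by apply: (@tens_cat _ _ _ [:: _] [:: _] [:: _] [:: _]);
  [apply/tens_sym/tens_Z|apply: tens_refl].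
Qed.

Lemma tens_sumE (x : V ⊗ W) : x = \sum_(p <- repr x) p.1 ⊗t p.2.
Proof.
rewrite -[LHS]reprK; elim: (repr x) => [|[v w] s IHs]; first by rewrite big_nil.
by rewrite big_cons -IHs /GRing.add /= /tens tens_addE.
Qed.

Section Lift.
Variables (U : lmodType k) (f : V -> W -> U).
Hypothesis f_bil : bilinear_for *:%R *:%R f.

Lemma bilinear0l w : f 0 w = 0.
Proof.
by have := f_bil.1 w (-1) 0 0; rewrite /= scaler0 addr0 scaleN1r addNr.
Qed.

Lemma bilinear0r v : f v 0 = 0.
Proof.
by have := f_bil.2 v (-1) 0 0; rewrite /= scaler0 addr0 scaleN1r addNr.
Qed.

Lemma tens_eq_sum s t : tens_eq s t ->
  \sum_(p <- s) f p.1 p.2 = \sum_(p <- t) f p.1 p.2.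
Proof.
elim=> {s t}
  [//|s t _ ->//|t s u _ -> _ -> //|s1 s2 t1 t2 _ h1 _ h2|s t|v v' w|v w w'|a v w|w].
- by rewrite !big_cat h1 h2.
- by rewrite !big_cat /= addrC.
- rewrite !big_cons !big_nil !addr0 /=.
  by have := f_bil.1 w 1 v v'; rewrite /= !scale1r.
- rewrite !big_cons !big_nil !addr0 /=.
  by have := f_bil.2 v 1 w w'; rewrite /= !scale1r.
- rewrite !big_cons !big_nil !addr0 /=.
  have := f_bil.1 w a v 0; have := f_bil.2 v a w 0.
  by rewrite /= !addr0 bilinear0l bilinear0r !addr0 => -> ->.
- by rewrite big_cons !big_nil /= bilinear0l addr0.
Qed.

Lemma tens_lift_pi s :
  tens_lift f (\pi_(V ⊗ W) s) = \sum_(p <- s) f p.1 p.2.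
Proof. exact: tens_eq_sum (tens_reprP s). Qed.

Lemma tens_liftE v w : tens_lift f (v ⊗t w) = f v w.
Proof. by rewrite tens_lift_pi big_cons big_nil addr0. Qed.

Lemma tens_lift_linear : linear (tens_lift f : V ⊗ W -> U).
Proof.
move=> a x y; rewrite -[x]reprK -[y]reprK.
rewrite {1}/GRing.scale {1}/GRing.add /= tens_scaleE tens_addE.
rewrite !tens_lift_pi big_cat big_map scaler_sumr; congr (_ + _).
apply: eq_bigr => p _ /=; have := f_bil.1 p.2 a p.1 0.
by rewrite /= bilinear0l !addr0.
Qed.

End Lift.

Lemma tens_linear_ext (U : lmodType k) (f g : V ⊗ W -> U) :
  linear f -> linear g -> (forall v w, f (v ⊗t w) = g (v ⊗t w)) -> f =1 g.
Proof.
move=> fl gl fg x.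
have D (h : V ⊗ W -> U) : linear h -> {morph h : a b / a + b}.
  by move=> hl a b; have := hl 1 a b; rewrite !scale1r.
have Z (h : V ⊗ W -> U) : linear h -> h 0 = 0.
  by move=> hl; have := hl (-1) 0 0; rewrite scaler0 addr0 scaleN1r addNr.
rewrite [x]tens_sumE; elim: (repr x) => [|p s IHs].
  by rewrite big_nil !Z.
by rewrite big_cons !D // IHs fg.
Qed.

End TensorTheory.

Section TensorMaps.
Variable k : fieldType.

Definition tens_map (V V' W W' : lmodType k) (f : V -> V') (g : W -> W') :
  V ⊗ W -> V' ⊗ W' := tens_lift (fun v w => f v ⊗t g w).

Definition tens_assoc (U V W : lmodType k) : (U ⊗ V) ⊗ W -> U ⊗ (V ⊗ W) :=
  tens_lift (fun x w => tens_lift (fun u v => u ⊗t (v ⊗t w)) x).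

(* For subspaces A of V and B of W, this is the image of A ⊗ B in V ⊗ W,    *)
(* which is A ⊗ B itself since k is a field.                                *)
Definition tens_set (V W : lmodType k) (A : set V) (B : set W) : set (V ⊗ W) :=
  [set x | exists2 s : seq (V * W),
     {in s, forall p, A p.1 /\ B p.2} & x = \sum_(p <- s) p.1 ⊗t p.2].

Lemma tens_lift_ext (V W : lmodType k) (U : zmodType) (f g : V -> W -> U) :
  f =2 g -> tens_lift f =1 tens_lift g.
Proof. by move=> fg x; apply: eq_bigr => p _. Qed.

Lemma tens_lift_lin (V W U : lmodType k) (f g : V -> W -> U) c x :
  tens_lift (fun v w => c *: f v w + g v w) x =
  c *: tens_lift f x + tens_lift g x.
Proof. by rewrite /tens_lift big_split scaler_sumr. Qed.

Lemma tens_mapE (V V' W W' : lmodType k)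
    (f : {linear V -> V'}) (g : {linear W -> W'}) v w :
  tens_map f g (v ⊗t w) = f v ⊗t g w.
Proof.
apply: tens_liftE; split=> [w' a u u'|v' a u u'] /=; rewrite linearP.
  exact: (@tens_bilinear k V' W').1.
exact: (@tens_bilinear k V' W').2.
Qed.

Lemma tens_assocE (U V W : lmodType k) (u : U) (v : V) (w : W) :
  tens_assoc ((u ⊗t v) ⊗t w) = u ⊗t (v ⊗t w).
Proof.
pose B := @tens_bilinear k U (V ⊗ W); pose B' := @tens_bilinear k V W.
have bil w' : bilinear_for *:%R *:%R (fun u v => u ⊗t (v ⊗t w') : U ⊗ (V ⊗ W)).
  split=> [v' a x y|x a y z] /=; first exact: B.1.
  by have /= -> := B'.1 w' a y z; apply: B.2.
rewrite /tens_assoc tens_liftE ?(tens_liftE (bil _)) //.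
split=> [w' a x y|x a w1 w2] /=; first exact: tens_lift_linear (bil w') a x y.
rewrite -tens_lift_lin; apply: tens_lift_ext => u' v'.
by have /= -> := B'.2 v' a w1 w2; apply: B.2.
Qed.

End TensorMaps.

Section TensorAlgebra.
Variables (k : fieldType) (A B : algType k).
Implicit Types (x y z : A ⊗ B).

Definition tens_mul x y : A ⊗ B :=
  tens_lift (fun a b => tens_lift (fun a' b' => (a * a') ⊗t (b * b')) y) x.

Let tDl := (@tens_bilinear k A B).1.
Let tDr := (@tens_bilinear k A B).2.

Let inner_bil a b :
  bilinear_for *:%R *:%R (fun (a' : A) (b' : B) => (a * a') ⊗t (b * b')).
Proof.
split=> [b' c u v|a' c u v] /=.
  by rewrite mulrDr -scalerAr; have := tDl (b * b') c (a * u) (a * v).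
by rewrite mulrDr -scalerAr; have := tDr (a * a') c (b * u) (b * v).
Qed.

Let outer_bil y : bilinear_for *:%R *:%R
  (fun a b => tens_lift (fun a' b' => (a * a') ⊗t (b * b')) y).
Proof.
split=> [b c u v|a c u v] /=; rewrite -tens_lift_lin;
    apply: tens_lift_ext => a' b'; rewrite mulrDl -scalerAl.
  by have := tDl (b * b') c (u * a') (v * a').
by have := tDr (a * a') c (u * b') (v * b').
Qed.

Lemma tens_mul_linl y : linear (tens_mul^~ y).
Proof. exact: tens_lift_linear (outer_bil y). Qed.

Lemma tens_mul_linr x : linear (tens_mul x).
Proof.
move=> c y z; rewrite /tens_mul -tens_lift_lin.
by apply: tens_lift_ext => a b; rewrite (tens_lift_linear (inner_bil a b)).
Qed.

Lemma tens_mulE a b a' b' :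
  tens_mul (a ⊗t b) (a' ⊗t b') = (a * a') ⊗t (b * b').
Proof.
by rewrite /tens_mul (tens_liftE (outer_bil _)) (tens_liftE (inner_bil _ _)).
Qed.

Lemma tens_mulA : associative tens_mul.
Proof.
move=> x y z.
move: x; apply: tens_linear_ext => [c u v|c u v|a b].
- exact: tens_mul_linl.
- by rewrite !tens_mul_linl.
move: y; apply: tens_linear_ext => [c u v|c u v|a' b'].
- by rewrite tens_mul_linl tens_mul_linr.
- by rewrite tens_mul_linr tens_mul_linl.
move: z; apply: tens_linear_ext => [c u v|c u v|a'' b''].
- by rewrite !tens_mul_linr.
- exact: tens_mul_linr.
by rewrite !tens_mulE !mulrA.
Qed.

Lemma tens_mul1l : left_id (1 ⊗t 1) tens_mul.
Proof.
apply: tens_linear_ext => [c u v|c u v|a b] //; first exact: tens_mul_linr.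
by rewrite tens_mulE !mul1r.
Qed.

Lemma tens_mul1r : right_id (1 ⊗t 1) tens_mul.
Proof.
apply: tens_linear_ext => [c u v|c u v|a b] //; first exact: tens_mul_linl.
by rewrite tens_mulE !mulr1.
Qed.

Lemma tens_mulDl : left_distributive tens_mul +%R.
Proof. by move=> x y z; have := tens_mul_linl z 1 x y; rewrite !scale1r. Qed.

Lemma tens_mulDr : right_distributive tens_mul +%R.
Proof. by move=> x y z; have := tens_mul_linr x 1 y z; rewrite !scale1r. Qed.

HB.instance Definition _ := GRing.Zmodule_isPzRing.Build (A ⊗ B)
  tens_mulA tens_mul1l tens_mul1r tens_mulDl tens_mulDr.

End TensorAlgebra.

(* In counitl and counitr, k ⊗ C and C ⊗ k are identified with C by scaling. *)
HB.mixin Record isCoalgebra (k : fieldType) C of GRing.Lmodule k C := {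
  comul : {linear C -> (C ⊗ C)%type};
  counit : {scalar C};
  comulA : forall x,
    tens_assoc (tens_map comul idfun (comul x)) = tens_map idfun comul (comul x);
  counitl : forall x, tens_lift (fun y z => counit y *: z) (comul x) = x;
  counitr : forall x, tens_lift (fun y z => counit z *: y) (comul x) = x
}.

#[short(type="coalgType")]
HB.structure Definition Coalgebra (k : fieldType) :=
  {C of GRing.Lmodule k C & isCoalgebra k C}.

HB.mixin Record isBialgebra (k : fieldType) B of GRing.Algebra k B & Coalgebra k B := {
  comul_monoid_morphism : monoid_morphism (comul : B -> B ⊗ B);
  counit_monoid_morphism : monoid_morphism (counit : B -> k)
}.

#[short(type="bialgType")]
HB.structure Definition Bialgebra (k : fieldType) :=
  {B of GRing.Algebra k B & Coalgebra k B & isBialgebra k B}.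

HB.mixin Record hasAntipode (k : fieldType) H of Bialgebra k H := {
  antipode : {linear H -> H};
  antipodel : forall x : H,
    tens_lift (fun y z => antipode y * z) (comul x) = (counit x)%:A;
  antipoder : forall x : H,
    tens_lift (fun y z => y * antipode z) (comul x) = (counit x)%:A
}.

#[short(type="hopfAlgType")]
HB.structure Definition HopfAlgebra (k : fieldType) :=
  {H of Bialgebra k H & hasAntipode k H}.

Definition lspan (k : fieldType) (V : lmodType k) (A : set V) : set V :=
  smallest [set U : set V | submod_closed [in U]] A.

Section Coalgebra.
Variables (k : fieldType) (C : coalgType k).
Implicit Types D E : set C.

Definition subcoalgebra D : Prop :=
  submod_closed [in D] /\ forall x, D x -> tens_set D D (comul x).

Definition simple_subcoalgebra D : Prop :=
  [/\ subcoalgebra D, D <> [set 0] &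
      forall E, subcoalgebra E -> E `<=` D -> E = [set 0] \/ E = D].

Definition coradical : set C :=
  lspan (\bigcup_(D in simple_subcoalgebra) D).

Definition grouplike : set C :=
  [set g | comul g = g ⊗t g /\ counit g = 1].

Definition pointed : Prop := coradical = lspan grouplike.

End Coalgebra.

Definition acc (T : Type) (P : set (set T)) : Prop :=
  forall I : nat -> set T, (forall n, P (I n)) ->
  (forall n, I n `<=` I n.+1) ->
  exists N, forall n, (N <= n)%N -> I n = I N.

Section Noetherian.
Variable R : nzRingType.
Implicit Type I : set R.

Definition left_ideal I : Prop :=
  zmod_closed [in I] /\ forall a x, I x -> I (a * x).
Definition right_ideal I : Prop :=
  zmod_closed [in I] /\ forall a x, I x -> I (x * a).

Definition left_noetherian : Prop := acc left_ideal.
Definition right_noetherian : Prop := acc right_ideal.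

End Noetherian.

Arguments pointed {k} C.
Arguments coradical {k} C.
Arguments grouplike {k} C.

Definition subalgebra (k : fieldType) (A : algType k) (B : set A) : Prop :=
  subalg_closed [in B].

(* The generators s lie in B, so this is finite generation of B itself. *)
Definition affine (k : fieldType) (A : algType k) (B : set A) : Prop :=
  exists s : seq A, B = smallest (@subalgebra k A) [set` s].

Definition hopf_subalgebra (k : fieldType) (H : hopfAlgType k) (K : set H) :
    Prop :=
  [/\ subalgebra K, subcoalgebra K & forall x, K x -> K (antipode x)].

(* Main.v *)
(* A retraction phi : H -> K of left K-modules onto a Hopf subalgebra K shows *)
(* that K is determined by the right ideal K^+ H: theta(h) = S(h_1) phi(h_2)  *)
(* kills K^+ H, so if L^+ is contained in K^+ H then theta = counit on L and  *)
(* phi(l) = l_1 theta(l_2) = l on L, i.e. L is contained in K. Hence          *)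
(* right Noetherian H has ACC on Hopf subalgebras; the left case follows by   *)
(* passing to the opposite algebra and coalgebra.                             *)
(* The retraction comes from Zorn's lemma: since H is pointed, any            *)
(* K-submodule and left coideal N <> H has an x outside it with               *)
(* comul x = g ⊗ x modulo H ⊗ N for a group-like g, and Kx is then free       *)
(* modulo N.                                                                  *)
(* For affineness, an affine Hopf subalgebra A strictly inside K is enlarged  *)
(* within K by adjoining either a group-like element and its inverse, or an   *)
(* x with comul x = g ⊗ x + x ⊗ h modulo A ⊗ A; ACC ends this process.        *)

Require Import Defs.
From HB Require Import structures.
From mathcomp Require Import all_boot all_algebra.
From mathcomp Require Import boolp classical_sets.

Set Implicit Arguments.
Unset Strict Implicit.
Unset Printing Implicit Defensive.

Import GRing.Theory.

Local Open Scope ring_scope.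
Local Open Scope classical_set_scope.

(** * Subspaces and tensor slices *)

(** Each Hopf subalgebra K is encoded by the right ideal K^+ H ([aug]). This encoding reflects
    inclusions ([sub_of_aug]), so a chain of Hopf subalgebras stops as soon as the chain of its
    right ideals does ([right_noetherian_acc]). Reversing both product and coproduct ([opcop])
    preserves pointedness and Hopf subalgebras and exchanges the two Noetherian conditions
    ([left_noetherian_acc]).

    Recovering K from K^+ H requires K to be a direct summand of H as a left K-module
    ([complement_exists], [retraction_exists]). Pointedness enters through [pointed_socle]: a
    nonzero quotient of left coideals contains a line on which the coaction is given by a group-like
    element. Such a line spans a free K-module modulo what is already built ([socle_free]), so the
    complement can grow until it exhausts H.

    The same lemma, used on both sides, shows that a Hopf subalgebra A strictly inside K misses
    either a group-like element of K or an element that is skew primitive modulo A ⊗ A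
    ([skew_primitive_exists]). Adjoining it costs finitely many generators ([affine_extend]), so a
    Hopf subalgebra that is not affine would contain an endless strict chain.

    Sub-objects are handled through linear functionals: membership in A ⊗ B is tested on slices
    ([tens_set_slices]), and coideals become subspaces stable under the action of functionals. *)

Section Subspaces.
Variables (k : fieldType) (V : lmodType k).
Implicit Types (A U W : set V) (s : seq V).

Definition subspace U : Prop := submod_closed [in U].

Lemma subspaceI U : U 0 -> (forall a x y, U x -> U y -> U (a *: x + y)) ->
  subspace U.
Proof.
move=> U0 UP; split; first by apply/mem_set.
by move=> a x y /set_mem Ux /set_mem Uy; apply/mem_set/UP.
Qed.

Lemma subspaceP U a x y : subspace U -> U x -> U y -> U (a *: x + y).
Proof.
by move=> [_ UP] Ux Uy; apply/set_mem/UP; apply/mem_set.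
Qed.

Lemma subspace0 U : subspace U -> U 0.
Proof. by case=> /set_mem. Qed.

Lemma subspaceZ U a x : subspace U -> U x -> U (a *: x).
Proof.
by move=> sU Ux; rewrite -[_ *: _]addr0; apply: subspaceP => //; apply: subspace0.
Qed.

Lemma subspaceD U x y : subspace U -> U x -> U y -> U (x + y).
Proof. by move=> sU Ux Uy; rewrite -[x]scale1r; apply: subspaceP. Qed.

Lemma subspaceN U x : subspace U -> U x -> U (- x).
Proof. by move=> sU Ux; rewrite -scaleN1r; apply: subspaceZ. Qed.

Lemma subspaceB U x y : subspace U -> U x -> U y -> U (x - y).
Proof. by move=> sU Ux Uy; apply: subspaceD => //; apply: subspaceN. Qed.

Lemma subspace_sum U (I : eqType) (r : seq I) (F : I -> V) :
  subspace U -> (forall i, i \in r -> U (F i)) -> U (\sum_(i <- r) F i).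
Proof.
move=> sU UF; rewrite big_seq; apply: big_ind => //; first exact: subspace0.
by move=> x y; apply: subspaceD.
Qed.

Lemma subspace_cap U W : subspace U -> subspace W -> subspace (U `&` W).
Proof.
move=> sU sW; apply: subspaceI; first by split; apply: subspace0.
by move=> a x y [Ux Wx] [Uy Wy]; split; apply: subspaceP.
Qed.

Lemma lspan_min A U : subspace U -> A `<=` U -> lspan A `<=` U.
Proof. by move=> sU AU x; apply. Qed.

Lemma sub_lspan A : A `<=` lspan A.
Proof. by move=> x Ax U [_]; apply. Qed.

(** By Zorn there is a subspace M maximal among those containing U and missing v. Maximality puts
    every w in M + kv, with a unique coefficient of v; that coefficient is [f w]. *)
Lemma functional_separation U v : subspace U -> ~ U v ->
  exists f : V -> k, [/\ scalar f, forall u, U u -> f u = 0 & f v = 1].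
Proof.
move=> sU Uv.
pose P := [set W : set V | W = set0 \/ [/\ subspace W, U `<=` W & ~ W v]].
have [M [PM maxM]] : exists M, P M /\ forall B, M `<` B -> ~ P B.
  apply: Zorn_bigcup => F FP tot.
  have [[X FX [x Xx]]|F0] := pselect (exists2 X, F X & X !=set0); last first.
    left; rewrite -subset0 => y [X FX Xy]; case: F0; exists X => //.
    by exists y.
  have nz Y y : F Y -> Y y -> [/\ subspace Y, U `<=` Y & ~ Y v].
    by move=> FY Yy; case: (FP _ FY) => [Y0|]; [move: Yy; rewrite Y0|].
  have [sX UX _] := nz _ _ FX Xx.
  right; split; last by move=> [Y FY Yv]; have [_ _] := nz _ _ FY Yv; apply.
    apply: subspaceI; first by exists X => //; apply: subspace0.
    move=> a y z [Y FY Yy] [Z FZ Zz].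
    have [sY _ _] := nz _ _ FY Yy; have [sZ _ _] := nz _ _ FZ Zz.
    by case: (tot _ _ FY FZ) => YZ; [exists Z|exists Y] => //;
       apply: subspaceP => //; apply: YZ.
  by move=> u Uu; exists X => //; apply: UX.
case: PM => [M0|[sM UM Mv]].
  case: (maxM U); last by right; split.
  rewrite M0; split=> // /(_ 0); apply; exact: subspace0.
have span w : exists c, M (w - c *: v).
  have [Mw|Mw] := pselect (M w); first by exists 0; rewrite scale0r subr0.
  (* M + kw is strictly larger than M, so it must contain v; the coefficient of w there is nonzero
     because v is outside M. *)
  pose B := [set x | exists c, M (x - c *: w)].
  have sB : subspace B.
    apply: subspaceI; first by exists 0; rewrite scale0r subr0; apply: subspace0.
    move=> a x y [c Mx] [d My]; exists (a * c + d).
    rewrite scalerDl -scalerA opprD addrACA -scalerBr; exact: subspaceP.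
  have MB : M `<=` B by move=> x Mx; exists 0; rewrite scale0r subr0.
  have [c Mc] : B v.
    apply: contrapT => Bv; case: (maxM B); last first.
      by right; split=> // x /UM /MB.
    split=> // BM; apply: Mw; apply: BM; exists 1; rewrite scale1r subrr.
    exact: subspace0.
  have c0 : c != 0 by apply/eqP => c0; move: Mc; rewrite c0 scale0r subr0.
  exists c^-1; have := subspaceZ (- c^-1) sM Mc.
  by rewrite scalerBr scalerA mulNr mulVf // !scaleNr scale1r opprK addrC.
have uniq_coef w c d : M (w - c *: v) -> M (w - d *: v) -> c = d.
  move=> Mc Md; apply/eqP; rewrite -subr_eq0; apply/eqP.
  apply: contrapT => /eqP cd; apply: Mv.
  have := subspaceZ (c - d)^-1 sM (subspaceB sM Md Mc).
  rewrite opprB [X in _ *: X]addrC addrA subrK -scalerBl scalerA mulVf ?scale1r //.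
have /choice[f fP] := span.
exists f; split=> [a x y|u Uu|].
- apply: (uniq_coef (a *: x + y)) => //.
  rewrite scalerDl -scalerA opprD addrACA -scalerBr; exact: subspaceP.
- by apply: (uniq_coef u) => //; rewrite scale0r subr0; apply: UM.
- by apply: (uniq_coef v) => //; rewrite scale1r subrr; apply: subspace0.
Qed.

Fixpoint spanl s : set V :=
  if s is a :: s' then [set v | exists c, spanl s' (v - c *: a)] else [set 0].

Lemma subspace_spanl s : subspace (spanl s).
Proof.
elim: s => [|b s IHs] /=.
  by apply: subspaceI => // a x y -> ->; rewrite scaler0 addr0.
apply: subspaceI; first by exists 0; rewrite scale0r subr0; apply: subspace0.
move=> a x y [c Mx] [d My]; exists (a * c + d).
rewrite scalerDl -scalerA opprD addrACA -scalerBr; exact: subspaceP.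
Qed.

Lemma spanl_mem s x : x \in s -> spanl s x.
Proof.
elim: s => [//|a s IHs]; rewrite inE => /orP[/eqP->|/IHs sx] /=.
  by exists 1; rewrite scale1r subrr; exact: subspace0 (subspace_spanl s).
by exists 0; rewrite scale0r subr0.
Qed.

Lemma spanl_min s U : subspace U -> (forall x, x \in s -> U x) ->
  spanl s `<=` U.
Proof.
move=> sU; elim: s => [|a s IHs] Us v /=.
  by move->; apply: subspace0.
case=> c sv; rewrite -(subrK (c *: a) v); apply: subspaceD => //.
  by apply: IHs sv => x xs; apply: Us; rewrite inE xs orbT.
by apply: subspaceZ => //; apply: Us; rewrite mem_head.
Qed.

(** Induction on the spanning list a :: s. Let U0 minimize the trace on the span of s. If a member
    with that trace lies inside this span, it is minimal. Otherwise any member W below U0 has the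
    same trace and contains some w with nonzero a-coordinate, and subtracting multiples of w brings
    all of U0 into W. *)
Lemma spanl_artinian s (P : set (set V)) :
  (forall U, P U -> subspace U /\ U `<=` spanl s) -> (exists U, P U) ->
  exists2 U, P U & forall W, P W -> W `<=` U -> W = U.
Proof.
elim: s P => [|a s IHs] P Psub [U PU].
  exists U => // W PW WU; rewrite eqEsubset; split=> // x /(Psub U PU).2 ->.
  exact: subspace0 (Psub W PW).1.
pose Q := [set U' | exists2 U, P U & U' = U `&` spanl s].
have [_ [U0 PU0 ->] minU0] : exists2 U, Q U & forall W, Q W -> W `<=` U -> W = U.
  apply: IHs; last by exists (U `&` spanl s); exists U.
  move=> _ [U' PU' ->]; split; last by apply: subIset; right.
  by apply: subspace_cap; [exact: (Psub _ PU').1|apply: subspace_spanl].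
have minI W T : P W -> W `<=` T -> T `&` spanl s = U0 `&` spanl s ->
    W `&` spanl s = T `&` spanl s.
  move=> PW WT eT; rewrite eT; apply: minU0; first by exists W.
  by rewrite -eT; apply: setSI.
have [[U1 PU1 [e1 U1s]]|noflat] := pselect (exists2 U1, P U1 &
    U1 `&` spanl s = U0 `&` spanl s /\ U1 `<=` spanl s).
  exists U1 => // W PW WU; rewrite eqEsubset; split=> // x Ux.
  have: (W `&` spanl s) x; last by case.
  by rewrite (minI _ _ PW WU e1); split=> //; apply: U1s.
exists U0 => // W PW WU; rewrite eqEsubset; split=> // u Uu.
have eW := minI _ _ PW WU erefl.
have [w [Ww ws]] : exists w, W w /\ ~ spanl s w.
  apply: contrapT => h; apply: noflat; exists W => //; split=> // w Ww.
  by apply: contrapT => ws; apply: h; exists w.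
have [sW /(_ _ Ww)/= [c sc]] := Psub W PW.
have [sU /(_ _ Uu)/= [d sd]] := Psub U0 PU0.
have c0 : c != 0 by apply/eqP => c0; apply: ws; move: sc; rewrite c0 scale0r subr0.
have [] : (W `&` spanl s) (u - (d / c) *: w).
  rewrite eW; split; first by apply: subspaceB => //; apply: subspaceZ => //; apply: WU.
  have := subspaceP (- (d / c)) (subspace_spanl s) sc sd.
  by rewrite scalerBr scalerA mulNr divfK // !scaleNr opprK addrACA subrr addr0 addrC.
move=> Wd _; rewrite -(subrK ((d / c) *: w) u).
by apply: subspaceD => //; apply: subspaceZ.
Qed.

End Subspaces.

(** * Slicing tensors by linear functionals *)

Section Slices.
Variables (k : fieldType) (V W : lmodType k).
Implicit Types (t : V ⊗ W) (f : V -> k) (g : W -> k).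

Lemma lin_sum (X Y : lmodType k) (f : X -> Y) (I : Type) (r : seq I) F :
  linear f -> f (\sum_(i <- r) F i) = \sum_(i <- r) f (F i).
Proof.
move=> fl; have f0 : f 0 = 0.
  by have := fl (-1) 0 0; rewrite scaler0 addr0 scaleN1r addNr.
elim: r => [|i r IHr]; first by rewrite !big_nil.
by rewrite !big_cons -IHr; have := fl 1 (F i) (\sum_(j <- r) F j); rewrite !scale1r.
Qed.

Lemma lin_morph (X Y : lmodType k) (f : X -> Y) : linear f ->
  [/\ f 0 = 0, {morph f : x y / x + y}, {morph f : x y / x - y} &
      forall a, {morph f : x / a *: x}].
Proof.
move=> fl; have f0 : f 0 = 0.
  by have := fl (-1) 0 0; rewrite scaler0 addr0 scaleN1r addNr.
split=> //.
- by move=> x y; have := fl 1 x y; rewrite !scale1r.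
- by move=> x y; rewrite [x - y]addrC [f x - f y]addrC -!scaleN1r fl.
- by move=> a x; have := fl a x 0; rewrite f0 !addr0.
Qed.

Lemma tens0l w : (0 : V) ⊗t w = 0 :> V ⊗ W.
Proof. exact: (bilinear0l (@tens_bilinear k V W)). Qed.
Lemma tens0r v : v ⊗t (0 : W) = 0 :> V ⊗ W.
Proof. exact: (bilinear0r (@tens_bilinear k V W)). Qed.
Lemma tensDl v v' w : (v + v') ⊗t w = v ⊗t w + v' ⊗t w :> V ⊗ W.
Proof.
by have /= := (@tens_bilinear k V W).1 w 1 v v'; rewrite !scale1r.
Qed.
Lemma tensDr v w w' : v ⊗t (w + w') = v ⊗t w + v ⊗t w' :> V ⊗ W.
Proof.
by have /= := (@tens_bilinear k V W).2 v 1 w w'; rewrite !scale1r.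
Qed.
Lemma tensZl a v w : (a *: v) ⊗t w = a *: (v ⊗t w) :> V ⊗ W.
Proof.
by have /= := (@tens_bilinear k V W).1 w a v 0; rewrite !addr0 tens0l addr0.
Qed.
Lemma tensZr a v w : v ⊗t (a *: w) = a *: (v ⊗t w) :> V ⊗ W.
Proof.
by have /= := (@tens_bilinear k V W).2 v a w 0; rewrite !addr0 tens0r addr0.
Qed.

Definition slicel f t : W := tens_lift (fun v w => f v *: w) t.
Definition slicer g t : V := tens_lift (fun v w => g w *: v) t.

Lemma slicel_bil f : scalar f ->
  bilinear_for *:%R *:%R (fun v (w : W) => f v *: w).
Proof.
move=> fs; split=> [w a x y|v a x y] /=; first by rewrite fs scalerDl scalerA.
by rewrite scalerDr !scalerA mulrC.
Qed.

Lemma slicer_bil g : scalar g ->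
  bilinear_for *:%R *:%R (fun (v : V) w => g w *: v).
Proof.
move=> gs; split=> [w a x y|v a x y] /=; last by rewrite gs scalerDl scalerA.
by rewrite scalerDr !scalerA mulrC.
Qed.

Lemma slicel_linear f : scalar f -> linear (slicel f).
Proof. by move=> /slicel_bil; apply: tens_lift_linear. Qed.
Lemma slicer_linear g : scalar g -> linear (slicer g).
Proof. by move=> /slicer_bil; apply: tens_lift_linear. Qed.

Lemma slicelE f v w : scalar f -> slicel f (v ⊗t w) = f v *: w.
Proof. by move=> fs; rewrite /slicel (tens_liftE (slicel_bil fs)). Qed.
Lemma slicerE g v w : scalar g -> slicer g (v ⊗t w) = g w *: v.
Proof. by move=> gs; rewrite /slicer (tens_liftE (slicer_bil gs)). Qed.

Lemma slicel_sum f (s : seq (V * W)) : scalar f ->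
  slicel f (\sum_(p <- s) p.1 ⊗t p.2) = \sum_(p <- s) f p.1 *: p.2.
Proof.
move=> fs; rewrite (lin_sum _ _ (slicel_linear fs)).
by apply: eq_bigr => p _; rewrite slicelE.
Qed.

Lemma slicer_sum g (s : seq (V * W)) : scalar g ->
  slicer g (\sum_(p <- s) p.1 ⊗t p.2) = \sum_(p <- s) g p.2 *: p.1.
Proof.
move=> fs; rewrite (lin_sum _ _ (slicer_linear fs)).
by apply: eq_bigr => p _; rewrite slicerE.
Qed.

Lemma tens_set0 (A : set V) (B : set W) : tens_set A B 0.
Proof. by exists [::]; rewrite ?big_nil. Qed.

Lemma tens_setD (A : set V) (B : set W) x y :
  tens_set A B x -> tens_set A B y -> tens_set A B (x + y).
Proof.
move=> [s sP ->] [t tP ->]; exists (s ++ t); last by rewrite big_cat.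
by move=> p; rewrite mem_cat => /orP[/sP|/tP].
Qed.

Lemma tens_set_tens (A : set V) (B : set W) v w :
  A v -> B w -> tens_set A B (v ⊗t w).
Proof.
move=> Av Bw; exists [:: (v, w)]; last by rewrite big_seq1.
by move=> p; rewrite inE => /eqP->.
Qed.

Lemma subspace_tens_set (A : set V) (B : set W) :
  subspace A -> subspace (tens_set A B).
Proof.
move=> sA; apply: subspaceI; first exact: tens_set0.
move=> a x y [s sP ->] ty; apply: tens_setD => //.
exists [seq (a *: p.1, p.2) | p <- s].
  by move=> _ /mapP[p /sP[Ap Bp] ->]; split=> //; apply: subspaceZ.
by rewrite big_map scaler_sumr; apply: eq_bigr => p _; rewrite /= tensZl.
Qed.

Lemma slicel_tens_set (A : set V) (B : set W) f t : subspace B -> scalar f ->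
  tens_set A B t -> B (slicel f t).
Proof.
move=> sB fs [s sP ->]; rewrite slicel_sum //.
by apply: subspace_sum => // p /sP[_ Bp]; apply: subspaceZ.
Qed.

Lemma slicer_tens_set (A : set V) (B : set W) g t : subspace A -> scalar g ->
  tens_set A B t -> A (slicer g t).
Proof.
move=> sB fs [s sP ->]; rewrite slicer_sum //.
by apply: subspace_sum => // p /sP[Ap _]; apply: subspaceZ.
Qed.

(** Expanding v in the first factors changes only the second factors. The number of terms thus drops
    by one, which feeds the induction of [tens_set_slices]. *)
Lemma tens_absorbl v w (s : seq (V * W)) : spanl (map fst s) v ->
  exists2 s', size s' = size s &
    v ⊗t w + \sum_(p <- s) p.1 ⊗t p.2 = \sum_(p <- s') p.1 ⊗t p.2.
Proof.
elim: s v => [|[a b] s IHs] v /=.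
  by move->; exists [::]; rewrite ?tens0l ?add0r.
move=> [c /IHs[s' ss' e]]; exists ((a, b + c *: w) :: s'); first by rewrite /= ss'.
rewrite !big_cons /= -e tensDr tensZr -tensZl addrCA -addrA; congr (_ + _).
by rewrite [RHS]addrA -tensDl [c *: a + _]addrC subrK.
Qed.

Lemma tens_absorbr v w (s : seq (V * W)) : spanl (map snd s) w ->
  exists2 s', size s' = size s &
    v ⊗t w + \sum_(p <- s) p.1 ⊗t p.2 = \sum_(p <- s') p.1 ⊗t p.2.
Proof.
elim: s w => [|[a b] s IHs] w /=.
  by move->; exists [::]; rewrite ?tens0r ?add0r.
move=> [c /IHs[s' ss' e]]; exists ((a + c *: v, b) :: s'); first by rewrite /= ss'.
rewrite !big_cons /= -e tensDl tensZl -tensZr addrCA -addrA; congr (_ + _).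
by rewrite [RHS]addrA -tensDr [c *: b + _]addrC subrK.
Qed.

(* Induction on the number of terms: a term whose factors are not in the     *)
(* spans of the remaining ones is recovered by slicing, hence subtracted.    *)
Lemma tens_set_slices (A : set V) (B : set W) t : subspace A -> subspace B ->
  (forall f, scalar f -> B (slicel f t)) ->
  (forall g, scalar g -> A (slicer g t)) -> tens_set A B t.
Proof.
move=> sA sB; rewrite [t]tens_sumE; move: (repr t) => s.
have [n] := ubnP (size s); elim: n s => // n IHn [|[v w] s] /=.
  by move=> _ _ _; rewrite big_nil; apply: tens_set0.
rewrite ltnS => sn hl hr; move: hl hr; rewrite big_cons /=.
have [/(tens_absorbl w)[s' ss' ->] hl hr|nv] := pselect (spanl (map fst s) v).
  by apply: IHn => //; rewrite ss'.
have [/(tens_absorbr v)[s' ss' ->] hl hr|nw] := pselect (spanl (map snd s) w).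
  by apply: IHn => //; rewrite ss'.
move=> hl hr.
have [f [fs f0 f1]] := functional_separation (@subspace_spanl _ _ _) nv.
have [g [gs g0 g1]] := functional_separation (@subspace_spanl _ _ _) nw.
have lD h x y : scalar h -> slicel h (x + y) = slicel h x + slicel h y.
  by move=> hs; have [_ ->] := lin_morph (slicel_linear hs).
have rD h x y : scalar h -> slicer h (x + y) = slicer h x + slicer h y.
  by move=> hs; have [_ ->] := lin_morph (slicer_linear hs).
have Bw : B w.
  have := hl f fs; rewrite lD // slicelE // f1 scale1r slicel_sum //.
  rewrite big_seq big1 ?addr0 // => p ps; rewrite f0 ?scale0r //.
  by apply: spanl_mem; apply: map_f.
have Av : A v.
  have := hr g gs; rewrite rD // slicerE // g1 scale1r slicer_sum //.
  rewrite big_seq big1 ?addr0 // => p ps; rewrite g0 ?scale0r //.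
  by apply: spanl_mem; apply: map_f.
apply: tens_setD; first exact: tens_set_tens.
apply: IHn => // h hs.
  have := hl h hs; rewrite lD // slicelE // => Bh.
  rewrite -[slicel _ _](addKr (h v *: w)); apply: subspaceD => //.
  by rewrite -scaleNr; apply: subspaceZ.
have := hr h hs; rewrite rD // slicerE // => Ah.
rewrite -[slicer _ _](addKr (h w *: v)); apply: subspaceD => //.
by rewrite -scaleNr; apply: subspaceZ.
Qed.

End Slices.

(** * Separation of points and spans of arbitrary sets *)

Section Functionals.
Variables (k : fieldType) (V : lmodType k).

Lemma scalarZ (f : V -> k) a v : scalar f -> f (a *: v) = a * f v.
Proof.
move=> fs; have [_ _ _ ->] // := @lin_morph k V k^o f fs.
Qed.

Lemma linear_scaled (W : lmodType k) (h : V -> k) (w : W) : scalar h ->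
  linear (fun v => h v *: w).
Proof. by move=> hs a x y; rewrite hs scalerDl scalerA. Qed.

Lemma scalar_ext (x y : V) :
  (forall f, scalar f -> f x = f y) -> x = y.
Proof.
move=> fxy; apply: contrapT => xy.
have s0 : subspace [set 0 : V].
  by apply: subspaceI => // a u v -> ->; rewrite scaler0 addr0.
have [f [fs _ f1]] : exists f : V -> k,
    [/\ scalar f, forall u, [set 0] u -> f u = 0 & f (x - y) = 1].
  by apply: functional_separation => // /eqP; rewrite subr_eq0 => /eqP.
have [_ _ fB _] := @lin_morph k V k^o f fs.
by move/eqP: f1; rewrite fB fxy // subrr eq_sym oner_eq0.
Qed.

Lemma scalarD c (f g : V -> k) : scalar f -> scalar g ->
  scalar (fun v => c * f v + g v).
Proof.
move=> fs gs a x y; rewrite fs gs mulrDr mulrDr addrACA; congr (_ + _ + _).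
by rewrite mulrCA.
Qed.

Lemma scalar0 : scalar (fun _ : V => 0 : k).
Proof. by move=> a x y; rewrite mulr0 addr0. Qed.

Lemma lspan_sums (A : set V) :
  (forall a x, A x -> A (a *: x)) ->
  forall x, lspan A x -> exists2 s : seq V, (forall y, y \in s -> A y) &
    x = \sum_(y <- s) y.
Proof.
move=> AZ x; pose B := [set x | exists2 s : seq V, (forall y, y \in s -> A y) &
    x = \sum_(y <- s) y].
suff: lspan A `<=` B by apply.
apply: lspan_min => [|y Ay].
  apply: subspaceI; first by exists [::] => //; rewrite big_nil.
  move=> a _ _ [s sA ->] [t tA ->]; exists (map ( *:%R a) s ++ t).
    by move=> y; rewrite mem_cat => /orP[/mapP[z /sA Az ->]|/tA//]; apply: AZ.
  by rewrite big_cat big_map scaler_sumr.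
exists [:: y]; last by rewrite big_seq1.
by move=> z; rewrite inE => /eqP->.
Qed.

Lemma subspace_lspan (A : set V) : subspace (lspan A).
Proof.
apply: subspaceI => [U [sU _]|a x y hx hy U UP]; first exact: subspace0.
by have [sU _] := UP; apply: subspaceP => //; [apply: hx|apply: hy].
Qed.

Lemma lspan_spanl (A : set V) x : lspan A x ->
  exists2 s : seq V, (forall y, y \in s -> A y) & spanl s x.
Proof.
move=> Ax; pose B := [set y | exists a z, A z /\ y = a *: z].
have [||s sB ->] := @lspan_sums B _ x.
- by move=> a y [b [z [Az ->]]]; exists (a * b), z; rewrite scalerA.
- apply: lspan_min Ax; first exact: subspace_lspan.
  by move=> z Az; apply: sub_lspan; exists 1, z; rewrite scale1r.
elim: s sB => [|y s IHs] sB; first by exists [::] => //; rewrite big_nil.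
have [|t tA st] := IHs; first by move=> z zs; apply: sB; rewrite inE zs orbT.
have [a [z [Az ->]]] := sB y (mem_head _ _).
exists (z :: t); first by move=> w; rewrite inE => /orP[/eqP->//|/tA].
by exists a; rewrite big_cons addrC addKr.
Qed.

End Functionals.

(** * Coalgebras and the action of functionals *)

Lemma tens_assoc_linear (k : fieldType) (U V W : lmodType k) :
  linear (@tens_assoc k U V W).
Proof.
apply: tens_lift_linear; split=> [w' a u v|u a y z] /=.
  apply: tens_lift_linear; split=> [w a' b c|v' a' b c] /=.
    by rewrite tensDl tensZl.
  by rewrite tensDl tensDr tensZl tensZr.
rewrite -tens_lift_lin; apply: tens_lift_ext => a' b'.
by rewrite tensDr tensDr tensZr tensZr.
Qed.

Section Sweedler.
Variables (k : fieldType) (C : coalgType k).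
Implicit Types (x : C).

(** The sum of F(x_1, x_2) in Sweedler notation, to be used with a bilinear F. *)
Definition sweedler (U : zmodType) (F : C -> C -> U) (x : C) : U :=
  tens_lift F (comul x).

Lemma eq_sweedler (U : zmodType) (F G : C -> C -> U) x :
  F =2 G -> sweedler F x = sweedler G x.
Proof. by move=> FG; apply: tens_lift_ext. Qed.

Lemma sweedler_linear (U : lmodType k) (F : C -> C -> U) :
  (forall b, linear (F^~ b)) -> (forall a, linear (F a)) -> linear (sweedler F).
Proof.
by move=> Fl Fr a x y; rewrite /sweedler linearP; apply: tens_lift_linear.
Qed.

Lemma lin_sweedler (U X : lmodType k) (g : U -> X) (F : C -> C -> U) x :
  linear g -> g (sweedler F x) = sweedler (fun a b => g (F a b)) x.
Proof. by move=> gl; rewrite /sweedler /tens_lift (lin_sum _ _ gl). Qed.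

Lemma sweedlerP (U : lmodType k) (F G : C -> C -> U) c x :
  sweedler (fun a b => c *: F a b + G a b) x = c *: sweedler F x + sweedler G x.
Proof. exact: tens_lift_lin. Qed.

Lemma sweedler_sum (U : lmodType k) (F : C -> C -> U) (s : seq (C * C)) x :
  (forall b, linear (F^~ b)) -> (forall a, linear (F a)) ->
  comul x = \sum_(p <- s) p.1 ⊗t p.2 ->
  sweedler F x = \sum_(p <- s) F p.1 p.2.
Proof.
move=> Fl Fr e; have Fb : bilinear_for *:%R *:%R F by split.
rewrite /sweedler e (lin_sum _ _ (tens_lift_linear Fb)).
by apply: eq_bigr => p _; rewrite (tens_liftE Fb).
Qed.

(** Coassociativity for a trilinear F: both sides are the sum of F(x_1, x_2, x_3). *)
Lemma sweedlerA (U : lmodType k) (F : C -> C -> C -> U) x :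
  (forall b c, linear (fun a => F a b c)) ->
  (forall a c, linear (fun b => F a b c)) ->
  (forall a b, linear (F a b)) ->
  sweedler (fun a b => sweedler (fun c d => F c d b) a) x =
  sweedler (fun a b => sweedler (fun c d => F a c d) b) x.
Proof.
move=> F1 F2 F3.
have Fb a : bilinear_for *:%R *:%R (F a) by split=> [c|b]; [apply: F2|apply: F3].
pose G0 a (u : C ⊗ C) := tens_lift (F a) u.
have G0b : bilinear_for *:%R *:%R G0.
  split=> [u c a b|a]; last exact: tens_lift_linear (Fb a).
  rewrite /G0 /= -tens_lift_lin; apply: tens_lift_ext => a' b'; exact: F1.
have Gl : linear (tens_lift G0 : C ⊗ (C ⊗ C) -> U) by apply: tens_lift_linear.
have := congr1 (tens_lift G0 : C ⊗ (C ⊗ C) -> U) (comulA x).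
have assoc_lin := @tens_assoc_linear k C C C.
rewrite [tens_map comul _ _]/tens_map [tens_map idfun _ _]/tens_map.
rewrite /(tens_lift (fun v w => comul v ⊗t idfun w) _).
rewrite (lin_sum _ _ assoc_lin) !(lin_sum _ _ Gl) => e.
rewrite /sweedler {1}/tens_lift [in RHS]/tens_lift.
transitivity (\sum_(p <- repr (comul x)) tens_lift G0 (tens_assoc (comul p.1 ⊗t p.2))).
  apply: eq_bigr => p _.
  rewrite {2}[comul p.1]tens_sumE.
  rewrite (@lin_sum k _ _ (fun t => tens_lift G0 (tens_assoc (t ⊗t p.2)))).
    by apply: eq_bigr => q _; rewrite tens_assocE (tens_liftE G0b) /G0 (tens_liftE (Fb _)).
  move=> a y z /=; rewrite tensDl tensZl assoc_lin; exact: Gl.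
rewrite e; apply: eq_bigr => p _; rewrite (tens_liftE G0b) //.
Qed.

(** The two actions of the dual algebra on C: [lhit] gives f(x_1) x_2 and [rhit] gives f(x_2) x_1.
    They commute by [lhit_rhit]. *)
Definition lhit (f : C -> k) x : C := slicel f (comul x).
Definition rhit (f : C -> k) x : C := slicer f (comul x).

Lemma lhitE f : lhit f = sweedler (fun a b => f a *: b).
Proof. by []. Qed.
Lemma rhitE f : rhit f = sweedler (fun a b => f b *: a).
Proof. by []. Qed.

Lemma lhit_linear f : scalar f -> linear (lhit f).
Proof.
by move=> fs a x y; rewrite /lhit linearP; apply: slicel_linear.
Qed.
Lemma rhit_linear f : scalar f -> linear (rhit f).
Proof.
by move=> fs a x y; rewrite /rhit linearP; apply: slicer_linear.
Qed.

Lemma scalar_lhit e f : scalar e -> scalar f -> scalar (e \o lhit f).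
Proof. by move=> es fs a x y /=; rewrite lhit_linear // es. Qed.
Lemma scalar_rhit e f : scalar e -> scalar f -> scalar (e \o rhit f).
Proof. by move=> es fs a x y /=; rewrite rhit_linear // es. Qed.

Lemma scalar_counit : scalar (counit : C -> k).
Proof. by move=> a x y; rewrite linearP. Qed.

Lemma lhit_counit x : lhit counit x = x.
Proof. exact: counitl. Qed.
Lemma rhit_counit x : rhit counit x = x.
Proof. exact: counitr. Qed.

Lemma lin_lhit (V : lmodType k) (h : C -> V) f x : linear h ->
  h (lhit f x) = sweedler (fun a b => f a *: h b) x.
Proof.
move=> hl; rewrite lhitE (lin_sweedler _ _ hl).
by have [_ _ _ hZ] := lin_morph hl; apply: eq_sweedler => a b; rewrite hZ.
Qed.

Lemma lin_rhit (V : lmodType k) (h : C -> V) f x : linear h ->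
  h (rhit f x) = sweedler (fun a b => f b *: h a) x.
Proof.
move=> hl; rewrite rhitE (lin_sweedler _ _ hl).
by have [_ _ _ hZ] := lin_morph hl; apply: eq_sweedler => a b; rewrite hZ.
Qed.

Lemma scalar_rhitE f g x : scalar f -> scalar g -> f (rhit g x) = g (lhit f x).
Proof.
move=> fs gs; rewrite (@lin_rhit k^o f _ _ fs) (@lin_lhit k^o g _ _ gs).
by apply: eq_sweedler => a b; rewrite /GRing.scale /= mulrC.
Qed.

Lemma scaler_sweedler (U : lmodType k) c (F : C -> C -> U) x :
  c *: sweedler F x = sweedler (fun a b => c *: F a b) x.
Proof. exact: scaler_sumr. Qed.

(** The functional [e \o lhit f] is the convolution product x |-> f(x_1) e(x_2), so this is the
    module law of the action. *)
Lemma lhit_lhit e f x : scalar e -> scalar f ->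
  lhit e (lhit f x) = lhit (e \o lhit f) x.
Proof.
move=> es fs; rewrite (lin_lhit _ _ (lhit_linear es)).
transitivity (sweedler (fun a b => sweedler (fun c d => (f a * e c) *: d) b) x).
  apply: eq_sweedler => a b; rewrite lhitE.
  rewrite scaler_sweedler.
  by apply: eq_sweedler => c d; rewrite scalerA.
rewrite -(@sweedlerA _ (fun a b c => (f a * e b) *: c)).
- apply: eq_sweedler => a b /=.
  rewrite (@lin_lhit k^o e _ _ es) (@lin_sweedler k^o C (fun z : k => z *: b)) //.
  by move=> c y z; rewrite scalerDl scalerA.
- by move=> b c; apply: linear_scaled => ? ? ?; rewrite fs mulrDl mulrA.
- move=> a c; apply: linear_scaled => ? ? ?; rewrite es mulrDr.
  by rewrite mulrCA.
- by move=> a b c y z; rewrite scalerDr !scalerA mulrC.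
Qed.

Lemma rhit_rhit e f x : scalar e -> scalar f ->
  rhit e (rhit f x) = rhit (e \o rhit f) x.
Proof.
move=> es fs; rewrite (lin_rhit _ _ (rhit_linear es)).
transitivity (sweedler (fun a b => sweedler (fun c d => (f b * e d) *: c) a) x).
  apply: eq_sweedler => a b; rewrite rhitE.
  rewrite scaler_sweedler.
  by apply: eq_sweedler => c d; rewrite scalerA.
rewrite (@sweedlerA _ (fun a b c => (f c * e b) *: a)).
- apply: eq_sweedler => a b /=.
  rewrite (@lin_rhit k^o e _ _ es) (@lin_sweedler k^o C (fun z : k => z *: a)) //.
  by move=> c y z; rewrite scalerDl scalerA.
- by move=> a b c y z; rewrite scalerDr !scalerA mulrC.
- move=> a c; apply: linear_scaled => ? ? ?; rewrite es mulrDr.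
  by rewrite mulrCA.
- by move=> b c; apply: linear_scaled => ? ? ?; rewrite fs mulrDl mulrA.
Qed.

Lemma lhit_rhit e f x : scalar e -> scalar f ->
  lhit e (rhit f x) = rhit f (lhit e x).
Proof.
move=> es fs; rewrite (lin_rhit _ _ (lhit_linear es)) (lin_lhit _ _ (rhit_linear fs)).
transitivity (sweedler (fun a b => sweedler (fun c d => (e c * f b) *: d) a) x).
  apply: eq_sweedler => a b; rewrite lhitE.
  rewrite scaler_sweedler.
  by apply: eq_sweedler => c d; rewrite scalerA mulrC.
rewrite (@sweedlerA _ (fun a b c => (e a * f c) *: b)).
- apply: eq_sweedler => a b /=; rewrite rhitE.
  rewrite scaler_sweedler.
  by apply: eq_sweedler => c d; rewrite scalerA.
- by move=> b c; apply: linear_scaled => ? ? ?; rewrite es mulrDl mulrA.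
- by move=> a b c y z; rewrite scalerDr !scalerA mulrC.
- move=> a c; apply: linear_scaled => ? ? ?; rewrite fs mulrDr.
  by rewrite mulrCA.
Qed.

Lemma lhit_grouplike f g : scalar f -> grouplike C g -> lhit f g = f g *: g.
Proof. by move=> fs [cg _]; rewrite /lhit cg slicelE. Qed.
(* Equivalently, the comultiplication maps N into C ⊗ N.                      *)
Definition lcoideal (N : set C) : Prop :=
  subspace N /\ forall f x, scalar f -> N x -> N (lhit f x).

(** The two actions compute the slices of [comul x], so [tens_set_slices] applies: subcoalgebras are
    the subspaces stable under both actions. *)
Lemma subcoalgebraP (D : set C) : subcoalgebra D <->
  lcoideal D /\ forall f x, scalar f -> D x -> D (rhit f x).
Proof.
split=> [[sD cD]|[[sD lD] rD]].
  split; [split=> //|]; move=> f x fs /cD.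
    exact: slicel_tens_set.
  exact: slicer_tens_set.
split=> // x Dx; apply: tens_set_slices => // f fs; [exact: lD|exact: rD].
Qed.

(** Since f acts on a group-like a as the scalar f(a), the operator [lhit f] minus f(a) stays in E
    and removes a from the expansion of x. If it kills x for every f, then x is a multiple of a. *)
Lemma grouplike_mem (E : set C) (s : seq C) x : lcoideal E -> E x -> x <> 0 ->
  (forall g, g \in s -> grouplike C g) -> spanl s x ->
  exists2 g, E g & grouplike C g.
Proof.
move=> [sE lE]; elim: s x => [//|a s IHs] x Ex x0 gs [c sx].
have ga : grouplike C a by apply: gs; rewrite mem_head.
have gs' g : g \in s -> grouplike C g by move=> h; apply: gs; rewrite inE h orbT.
have [[f [fs nz]]|h] := pselect (exists f, scalar f /\ lhit f x - f a *: x <> 0).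
  apply: (IHs (lhit f x - f a *: x)) => //.
    by apply: subspaceB => //; [apply: lE|apply: subspaceZ].
  have [l0 lD lB lZ] := lin_morph (lhit_linear fs).
  have -> : lhit f x - f a *: x = lhit f (x - c *: a) - f a *: (x - c *: a).
    rewrite lB lZ (lhit_grouplike fs ga) scalerBr opprB addrA.
    by rewrite scalerA [c * _]mulrC -scalerA subrK.
  apply: subspaceB; [exact: subspace_spanl| |]; last first.
    by apply: subspaceZ => //; apply: subspace_spanl.
  suff: spanl s `<=` [set y | spanl s (lhit f y)] by apply.
  apply: spanl_min.
    apply: subspaceI => [|b y z hy hz] /=.
      by rewrite l0; exact: subspace0 (subspace_spanl s).
    by rewrite lD lZ; apply: subspaceP => //; apply: subspace_spanl.
  move=> g sg /=; rewrite lhit_grouplike; [|by []|exact: gs'].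
  by apply: subspaceZ; [apply: subspace_spanl|apply: spanl_mem].
have xa : x = counit x *: a.
  apply: scalar_ext => f fs; rewrite scalarZ // -[x in LHS]rhit_counit.
  rewrite scalar_rhitE //; last exact: scalar_counit.
  have -> : lhit f x = f a *: x.
    by apply/eqP; rewrite -subr_eq0; apply/eqP; apply: contrapT => nz; apply: h; exists f.
  by rewrite (scalarZ _ _ scalar_counit) mulrC.
exists a => //.
have cx : counit x != 0 by apply/eqP => cx; apply: x0; rewrite xa cx scale0r.
have -> : a = (counit x)^-1 *: x by rewrite {2}xa scalerA mulVf // scale1r.
exact: subspaceZ.
Qed.

Lemma simple_subcoalgebra_exists (D : set C) (s : seq C) :
  subcoalgebra D -> D <> [set 0] -> D `<=` spanl s ->
  exists2 E, simple_subcoalgebra E & E `<=` D.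
Proof.
move=> cD D0 Ds.
have [|E [cE E0 ED] minE] := @spanl_artinian k C s
  [set E | [/\ subcoalgebra E, E <> [set 0] & E `<=` D]] _
  (ex_intro _ D (And3 cD D0 (@subset_refl _ D))).
  by move=> E [[sE _] _ ED]; split=> //; apply: subset_trans Ds.
exists E => //; split=> // E' cE' E'E.
have [->|E'0] := pselect (E' = [set 0]); [by left|right].
apply: minE => //; split=> //; exact: subset_trans ED.
Qed.

(** Finite dimension provides a simple subcoalgebra of D; it lies in the coradical, hence in the
    span of the group-likes, and [grouplike_mem] finishes. *)
Lemma pointed_grouplike (D : set C) (s : seq C) : pointed C ->
  subcoalgebra D -> D <> [set 0] -> D `<=` spanl s ->
  exists2 g, D g & grouplike C g.
Proof.
move=> ptd cD D0 Ds.
have [E sE ED] := simple_subcoalgebra_exists cD D0 Ds.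
have [cE E0 _] := sE; have [lE _] := (subcoalgebraP E).1 cE.
have [x [Ex x0]] : exists x, E x /\ x <> 0.
  apply: contrapT => h; apply: E0; rewrite eqEsubset; split=> [y Ey|_ ->].
    by apply: contrapT => y0; apply: h; exists y.
  exact: subspace0 lE.1.
have : lspan (grouplike C) x.
  by rewrite -[lspan _]ptd; apply: sub_lspan; exists E.
move=> /lspan_spanl[t tg tx].
by have [g Eg gg] := grouplike_mem lE Ex x0 tg tx; exists g => //; apply: ED.
Qed.

End Sweedler.

(** * Simple left coideals of pointed coalgebras *)

Section PointedSocle.
Variables (k : fieldType) (C : coalgType k).
Implicit Types (M N K : set C) (v x : C).

(** The left coideal generated by v; [orbit_spanl] shows that it is finite dimensional. *)
Definition orbit v : set C := [set x | exists2 f, scalar f & x = lhit f v].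

Lemma lhitDf c f g v : lhit (fun x => c * f x + g x) v = c *: lhit f v + lhit g v.
Proof.
rewrite !lhitE -sweedlerP; apply: eq_sweedler => a b.
by rewrite scalerDl scalerA.
Qed.

Lemma lhit0f v : lhit (fun=> 0) v = 0.
Proof. by rewrite lhitE /sweedler /tens_lift big1 // => p _; rewrite scale0r. Qed.

Lemma rhitZf c f v : scalar f -> rhit (fun x => c * f x) v = c *: rhit f v.
Proof.
move=> fs; rewrite !rhitE scaler_sweedler; apply: eq_sweedler => a b.
by rewrite scalerA.
Qed.

Lemma lcoideal_orbit v : lcoideal (orbit v).
Proof.
split.
  apply: subspaceI; first by exists (fun=> 0); [exact: scalar0|rewrite lhit0f].
  move=> a _ _ [f fs ->] [g gs ->]; exists (fun x => a * f x + g x).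
    exact: scalarD.
  by rewrite lhitDf.
move=> f _ fs [g gs ->]; exists (f \o lhit g); first exact: scalar_lhit.
by rewrite lhit_lhit.
Qed.

Lemma orbit_id v : orbit v v.
Proof. by exists counit; [exact: scalar_counit|rewrite lhit_counit]. Qed.

Lemma orbit_sub M v : lcoideal M -> M v -> orbit v `<=` M.
Proof. by move=> [_ lM] Mv _ [f fs ->]; apply: lM. Qed.

Lemma orbit_spanl v : orbit v `<=` spanl (map snd (repr (comul v))).
Proof.
move=> _ [f fs ->]; rewrite lhitE /sweedler /tens_lift.
apply: subspace_sum => [|p vp]; first exact: subspace_spanl.
apply: subspaceZ; first exact: subspace_spanl.
by apply: spanl_mem; apply: map_f.
Qed.

Lemma rhit_vanish N f v : lcoideal N -> scalar f -> (forall u, N u -> f u = 0) ->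
  N v -> rhit f v = 0.
Proof.
move=> [_ lN] fs f0 Nv; apply: scalar_ext => e es.
rewrite scalar_rhitE // f0; last exact: lN.
by have [->] := @lin_morph k C k^o e es.
Qed.

Section Coefficients.
Variables (N : set C) (v0 : C).

(* The coefficients of the comodule (orbit v0 + N) / N.                       *)
Definition coefs : set C := [set y | exists f v,
  [/\ scalar f, forall u, N u -> f u = 0, orbit v0 v & y = rhit f v]].

Hypothesis lN : lcoideal N.

Lemma coefsZ a y : coefs y -> coefs (a *: y).
Proof.
move=> [f [v [fs f0 Vv ->]]]; exists (fun x => a * f x), v; split=> //.
- by move=> b x z; rewrite fs mulrDr mulrCA.
- by move=> u Nu; rewrite f0 // mulr0.
- by rewrite rhitZf.
Qed.

(** On a coefficient [rhit f v], the left action moves v inside the orbit, and the right action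
    replaces f by [f \o lhit e], which still vanishes on N because N is a left coideal. *)
Lemma coefs_subcoalgebra : subcoalgebra (lspan coefs).
Proof.
have sD := subspace_lspan coefs.
have stab (T : C -> C) : linear T -> (forall y, coefs y -> coefs (T y)) ->
    forall y, lspan coefs y -> lspan coefs (T y).
  move=> Tl Tc; suff: lspan coefs `<=` [set y | lspan coefs (T y)] by [].
  have [T0 TD _ TZ] := lin_morph Tl.
  apply: lspan_min => [|y cy]; last by apply: sub_lspan; apply: Tc.
  apply: subspaceI => [|a x y hx hy] /=; first by rewrite T0; exact: subspace0 sD.
  by rewrite TD TZ; exact: subspaceP sD hx hy.
apply/subcoalgebraP; split; [split=> //|] => e x es.
  apply: (stab _ (lhit_linear es)) => //.
  move=> _ [f [v [fs f0 Vv ->]]]; exists f, (lhit e v); split=> //.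
    by apply: (lcoideal_orbit v0).2.
  by rewrite lhit_rhit.
apply: (stab _ (rhit_linear es)) => //.
move=> _ [f [v [fs f0 Vv ->]]]; exists (f \o lhit e), v; split=> //.
- exact: scalar_lhit.
- by move=> u Nu; apply: f0; apply: lN.2.
rewrite rhit_rhit //; apply: scalar_ext => h hs.
rewrite !scalar_rhitE //; [|exact: scalar_lhit|exact: scalar_rhit].
by rewrite /= scalar_rhitE.
Qed.

Lemma coefs_spanl : exists s, lspan coefs `<=` spanl s.
Proof.
exists (flatten [seq map snd (repr (comul p.1)) | p <- repr (comul v0)]).
apply: lspan_min => [|_ [f [_ [fs f0 [e es ->] ->]]]]; first exact: subspace_spanl.
rewrite -lhit_rhit // rhitE (lin_sweedler _ _ (lhit_linear es)).
rewrite /sweedler /tens_lift; apply: subspace_sum => [|p vp].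
  exact: subspace_spanl.
have [_ _ _ ->] := lin_morph (lhit_linear es).
apply: subspaceZ; first exact: subspace_spanl.
have /orbit_spanl : orbit p.1 (lhit e p.1) by exists e.
apply: spanl_min => [|x xp]; first exact: subspace_spanl.
apply: spanl_mem; apply/flattenP; exists (map snd (repr (comul p.1))) => //.
exact: (map_f (fun p => map snd (repr (comul p.1)))).
Qed.

End Coefficients.

(* A simple left coideal modulo N is one-dimensional: its coefficient        *)
(* coalgebra contains a group-like element g, and a shortest expression of g *)
(* as a sum of coefficients only involves vectors on which C acts through g. *)
Lemma pointed_socle M N K : pointed C -> lcoideal M -> lcoideal N ->
  subcoalgebra K -> M `<=` K -> ~ M `<=` N ->
  exists x g, [/\ M x, ~ N x, K g, grouplike C g &
    forall f, scalar f -> N (lhit f x - f g *: x)].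
Proof.
move=> ptd lM lN cK MK MN.
have [h [Mh Nh]] : exists h, M h /\ ~ N h.
  by apply: contrapT => nh; apply: MN => h Mh; apply: contrapT => Nh; apply: nh; exists h.
(* A minimal orbit generated by a vector outside N: every w in it outside N generates the whole
   orbit again, which is what [regen] records. *)
have [_ [v0 [hv0 Nv0] ->] minV] : exists2 U,
    [set V | exists2 v, orbit h v /\ ~ N v & V = orbit v] U &
    forall W, [set V | exists2 v, orbit h v /\ ~ N v & V = orbit v] W ->
      W `<=` U -> W = U.
  apply: (@spanl_artinian k C (map snd (repr (comul h)))); last first.
    by exists (orbit h), h => //; split=> //; apply: orbit_id.
  move=> _ [v [hv _] ->]; split; first exact: (lcoideal_orbit v).1.
  exact: subset_trans (orbit_sub (lcoideal_orbit h) hv) (@orbit_spanl h).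
have regen w : orbit v0 w -> ~ N w -> exists2 e, scalar e & v0 = lhit e w.
  move=> vw Nw; suff: orbit w v0 by [].
  rewrite (minV (orbit w)); first exact: orbit_id.
    by exists w => //; split=> //; apply: orbit_sub hv0 _ vw; apply: lcoideal_orbit.
  by apply: orbit_sub vw; apply: lcoideal_orbit.
have lV := lcoideal_orbit v0.
have cD := coefs_subcoalgebra v0 lN.
have [l Dl] := coefs_spanl N v0.
have D0 : lspan (coefs N v0) <> [set 0].
  move=> D0; have [f [fs f0 f1]] := functional_separation lN.1 Nv0.
  have : lspan (coefs N v0) (rhit f v0).
    by apply: sub_lspan; exists f, v0; split=> //; apply: orbit_id.
  rewrite D0 => /(congr1 counit); rewrite linear0 scalar_rhitE //; last first.
    exact: scalar_counit.
  by rewrite lhit_counit f1 => /eqP; rewrite oner_eq0.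
have [g Dg gg] := pointed_grouplike ptd cD D0 Dl.
have orbM : orbit v0 `<=` M.
  by apply: orbit_sub => //; apply: orbit_sub hv0 => //.
have Kg : K g.
  have [lK rK] := (subcoalgebraP K).1 cK.
  suff: lspan (coefs N v0) `<=` K by apply.
  apply: lspan_min => [|_ [f [v [fs _ Vv ->]]]]; first exact: lK.1.
  by apply: rK => //; apply: MK; apply: orbM.
have [s sc gE] := lspan_sums (@coefsZ N v0) Dg.
(* Induction on the number of coefficients summing to g. Each round either finds the required vector
   or rewrites g with one term fewer. *)
have [n] := ubnP (size s); elim: n s sc gE => // n IHn [|y1 s] sc gE.
  have [_ eg] := gg; move: eg; rewrite gE big_nil linear0 => /eqP.
  by rewrite eq_sym oner_eq0.
rewrite ltnS /= => sn.
have sc' y : y \in s -> coefs N v0 y by move=> ys; apply: sc; rewrite inE ys orbT.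
have [f1 [v1 [f1s f10 Vv1 y1E]]] := sc y1 (mem_head _ _).
move: gE; rewrite big_cons => gE.
have [Nv1|Nv1] := pselect (N v1).
  by apply: (IHn s) => //; rewrite gE y1E (rhit_vanish lN) ?add0r.
have [ok|bad] := pselect (forall f, scalar f -> N (lhit f v1 - f g *: v1)).
  by exists v1, g; split=> //; apply: orbM.
have [f [fs Nw]] : exists f, scalar f /\ ~ N (lhit f v1 - f g *: v1).
  apply: contrapT => nf; apply: bad => f fs; apply: contrapT => Nw.
  by apply: nf; exists f.
(* T kills g but sends v1 outside N, so some functional e carries T v1 back to v1. Then Q = 1 -
   [lhit e] T fixes g, commutes with the right action and kills y1: applying Q to the sum removes
   its first term. *)
pose T x := lhit f x - f g *: x.
have Tl : linear T.
  move=> a x y; rewrite /T lhit_linear // scalerDr scalerBr !scalerA.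
  by rewrite [f g * a]mulrC opprD addrACA.
have VT x : orbit v0 x -> orbit v0 (T x).
  by move=> Vx; apply: subspaceB lV.1 (lV.2 _ _ fs Vx) (subspaceZ _ lV.1 Vx).
have [e0 e0s v0E] := regen _ (VT _ Vv1) Nw.
have [e1 e1s v1E] := Vv1.
pose e := e1 \o lhit e0; have es : scalar e by apply: scalar_lhit.
have eT : lhit e (T v1) = v1 by rewrite -lhit_lhit // -v0E.
have el := lhit_linear es.
pose Q x := x - lhit e (T x).
have Ql : linear Q.
  move=> a x y; rewrite /Q Tl el scalerBr.
  by rewrite opprD addrACA.
have Qr h1 x : scalar h1 -> Q (rhit h1 x) = rhit h1 (Q x).
  move=> hs; have [_ _ rB rZ] := lin_morph (rhit_linear hs).
  by rewrite /Q /T rB -lhit_rhit // rB -[rhit h1 (lhit f x)]lhit_rhit // rZ.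
have Qg : Q g = g.
  rewrite /Q /T (lhit_grouplike fs gg) subrr.
  by have [-> _ _ _] := lin_morph el; rewrite subr0.
have Qy1 : Q y1 = 0.
  rewrite y1E Qr // /Q eT subrr.
  by have [-> _ _ _] := lin_morph (rhit_linear f1s).
apply: (IHn (map Q s)).
- move=> _ /mapP[y /sc'[f2 [v2 [f2s f20 Vv2 ->]]] ->].
  rewrite Qr //; exists f2, (Q v2); split=> //.
  by apply: subspaceB => //; [exact: lV.1|apply: lV.2 => //; apply: VT].
- by rewrite big_map -(lin_sum _ _ Ql) -[LHS]Qg gE; have [_ -> _ _] := lin_morph Ql;
    rewrite Qy1 add0r.
- by rewrite size_map.
Qed.

End PointedSocle.

(** * Antipode and generated Hopf subalgebras *)

Section HopfTheory.
Variables (k : fieldType) (H : hopfAlgType k).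
Implicit Types (x y : H) (B X : set H).

Local Notation S := (antipode : H -> H).

Lemma comulM x y : comul (x * y) = comul x * comul y :> H ⊗ H.
Proof. by have [_ ->] := @comul_monoid_morphism k H. Qed.
Lemma comul1 : comul (1 : H) = 1 ⊗t 1.
Proof. by have [-> _] := @comul_monoid_morphism k H. Qed.
Lemma counitM x y : counit (x * y) = counit x * counit y :> k.
Proof. by have [_ ->] := @counit_monoid_morphism k H. Qed.
Lemma counit1 : counit (1 : H) = 1 :> k.
Proof. by have [-> _] := @counit_monoid_morphism k H. Qed.

Lemma tensM (a b c d : H) : (a ⊗t b) * (c ⊗t d) = (a * c) ⊗t (b * d) :> H ⊗ H.
Proof. exact: tens_mulE. Qed.

Lemma sweedlerM (U : lmodType k) (F : H -> H -> U) x y :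
  (forall b, linear (F^~ b)) -> (forall a, linear (F a)) ->
  sweedler F (x * y) =
  sweedler (fun a b => sweedler (fun c d => F (a * c) (b * d)) y) x.
Proof.
move=> Fl Fr; have Fb : bilinear_for *:%R *:%R F by split.
have Flin := tens_lift_linear Fb.
rewrite {1}/sweedler comulM [comul x * _]/(tens_mul (comul x) (comul y)).
rewrite {2}/tens_lift (lin_sum _ _ Flin); apply: eq_bigr => p _.
rewrite {1}/tens_lift -/(tens_lift _ _) (lin_sum _ _ Flin).
by apply: eq_bigr => q _; rewrite (tens_liftE Fb).
Qed.

Lemma antipode_sweedlerl x : sweedler (fun a b => S a * b) x = (counit x)%:A.
Proof. exact: antipodel. Qed.
Lemma antipode_sweedlerr x : sweedler (fun a b => a * S b) x = (counit x)%:A.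
Proof. exact: antipoder. Qed.

Lemma antipode1 : S 1 = 1.
Proof.
have := antipode_sweedlerl 1; rewrite counit1 scale1r /sweedler comul1.
rewrite tens_liftE ?mulr1 //; split=> [w|v] a y z /=.
  by rewrite linearP mulrDl -scalerAl.
by rewrite mulrDr -scalerAr.
Qed.

Lemma sweedler_mull c (F : H -> H -> H) x :
  c * sweedler F x = sweedler (fun a b => c * F a b) x.
Proof. exact: mulr_sumr. Qed.
Lemma sweedler_mulr c (F : H -> H -> H) x :
  sweedler F x * c = sweedler (fun a b => F a b * c) x.
Proof. exact: mulr_suml. Qed.

(** Insert S(x_1) x_2 in front: the sum becomes S(x_1) times (x_2 y_1) S(x_3 y_2), which collapses
    by the antipode axiom for the product x_2 y. *)
Lemma antipode_absorb x y :
  sweedler (fun a b => a * S (x * b)) y = counit y *: S x.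
Proof.
pose Q z := sweedler (fun a b => a * S (z * b)) y.
have Ql : linear Q.
  move=> a u v; rewrite /Q -sweedlerP; apply: eq_sweedler => c d.
  by rewrite mulrDl -scalerAl linearP mulrDr -scalerAr.
have [_ _ _ QZ] := lin_morph Ql.
rewrite -/(Q x) -{1}[x]lhit_counit (lin_lhit _ _ Ql).
transitivity (sweedler (fun a b => sweedler (fun c d => S c * d * Q b) a) x).
  apply: eq_sweedler => a b.
  by rewrite -sweedler_mulr antipode_sweedlerl -scalerAl mul1r.
rewrite (@sweedlerA _ _ _ (fun a b c => S a * b * Q c)).
- transitivity (sweedler (fun a b => (counit b * counit y) *: S a) x).
    apply: eq_sweedler => a b.
    transitivity (S a * sweedler (fun c d => c * S d) (b * y)).
      rewrite sweedlerM; last 2 first.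
      - by move=> z c u v; rewrite mulrDl -scalerAl.
      - by move=> z c u v; rewrite linearP mulrDr -scalerAr.
      rewrite sweedler_mull; apply: eq_sweedler => c d.
      rewrite sweedler_mull /Q sweedler_mull; apply: eq_sweedler => e f.
      by rewrite !mulrA.
    by rewrite antipode_sweedlerr counitM -scalerAr mulr1.
  rewrite -{2}[x]rhit_counit.
  rewrite (@lin_rhit _ _ _ S); last by move=> a u v; rewrite linearP.
  rewrite scaler_sweedler; apply: eq_sweedler => a b.
  by rewrite scalerA mulrC.
- by move=> b c a u v; rewrite linearP !mulrDl -!scalerAl.
- by move=> a c b u v; rewrite mulrDr mulrDl -scalerAr -scalerAl.
- by move=> a b c u v; rewrite Ql mulrDr -scalerAr.
Qed.

(** S(xy) = S(y_1) y_2 S(x y_3), and [antipode_absorb] collapses the last two factors. *)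
Lemma antipodeM x y : S (x * y) = S y * S x.
Proof.
rewrite -{2}[y]rhit_counit.
rewrite (@lin_rhit _ _ _ S); last by move=> a u v; rewrite linearP.
rewrite sweedler_mulr.
transitivity (sweedler (fun a b => sweedler (fun c d => S a * c * S (x * d)) b) y).
  rewrite -(@sweedlerA _ _ _ (fun a b c => S a * b * S (x * c))).
  - transitivity (sweedler (fun a b => counit a *: S (x * b)) y).
      rewrite -{1}[y]lhit_counit (@lin_lhit _ _ _ (fun z => S (x * z))) //.
      by move=> a u v; rewrite mulrDr -scalerAr linearP.
    apply: eq_sweedler => a b.
    by rewrite -sweedler_mulr antipode_sweedlerl -scalerAl mul1r.
  - by move=> b c a u v; rewrite linearP !mulrDl -!scalerAl.
  - by move=> a c b u v; rewrite mulrDr mulrDl -scalerAr -scalerAl.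
  - by move=> a b c u v; rewrite mulrDr -scalerAr linearP mulrDr -scalerAr.
apply: eq_sweedler => a b.
rewrite -[LHS]/(sweedler _ _) -scalerAl scalerAr -antipode_absorb sweedler_mull.
by apply: eq_sweedler => c d; rewrite mulrA.
Qed.

Lemma subalgebraI B : subspace B -> B 1 -> (forall x y, B x -> B y -> B (x * y)) ->
  subalgebra B.
Proof.
move=> [_ sB] B1 BM; split=> //; first exact/mem_set.
by move=> x y /set_mem Bx /set_mem By; apply/mem_set/BM.
Qed.

Lemma subalgebraP B : subalgebra B ->
  [/\ subspace B, B 1 & forall x y, B x -> B y -> B (x * y)].
Proof.
move=> [/set_mem B1 BP BM].
have B0 : B 0.
  have := BP (-1) 1 1 (mem_set B1) (mem_set B1).
  by rewrite scaleN1r addNr => /set_mem.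
split=> //; first by split=> //; apply/mem_set.
by move=> x y /mem_set Bx /mem_set By; apply/set_mem/BM.
Qed.

Definition gen X : set H := smallest (@subalgebra k H) X.

Lemma gen_min X B : subalgebra B -> X `<=` B -> gen X `<=` B.
Proof. by move=> sB XB x; apply. Qed.

Lemma sub_gen X : X `<=` gen X.
Proof. by move=> x Xx B [_]; apply. Qed.

Lemma gen_subalgebra X : subalgebra (gen X).
Proof.
apply: subalgebraI.
- apply: subspaceI => [B [/subalgebraP[sB _ _] _]|a x y hx hy B sB].
    exact: subspace0 sB.
  have [/subalgebraP[sB' _ _] _] := sB.
  exact: subspaceP sB' (hx _ sB) (hy _ sB).
- by move=> B [/subalgebraP[]].
- move=> x y hx hy B sB; have [/subalgebraP[_ _ BM] _] := sB.
  exact: BM (hx _ sB) (hy _ sB).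
Qed.

Lemma tens_setM B (x y : H ⊗ H) : subalgebra B ->
  tens_set B B x -> tens_set B B y -> tens_set B B (x * y).
Proof.
move=> /subalgebraP[sB _ BM] [s sP ->] [t tP ->].
have sT : subspace (tens_set B B) by apply: subspace_tens_set.
rewrite mulr_suml; apply: subspace_sum => // p /sP[p1 p2].
rewrite mulr_sumr; apply: subspace_sum => // q /tP[q1 q2].
by rewrite tensM; apply: tens_set_tens; apply: BM.
Qed.

(** Both conditions define subalgebras of H, since [comul] is multiplicative and S
    antimultiplicative; checking generators is therefore enough. *)
Lemma gen_hopf X : (forall x, X x -> tens_set (gen X) (gen X) (comul x)) ->
  (forall x, X x -> gen X (S x)) -> hopf_subalgebra (gen X).
Proof.
move=> Xc XS; have sG := gen_subalgebra X; have [sG' G1 GM] := subalgebraP sG.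
split=> //.
- split=> // x; move: x; apply: gen_min => //.
  apply: subalgebraI.
  + apply: subspaceI => [|a x y hx hy] /=; first by rewrite linear0; apply: tens_set0.
    by rewrite linearP; apply: subspaceP => //; apply: subspace_tens_set.
  + by rewrite /= comul1; apply: tens_set_tens.
  + by move=> x y /= hx hy; rewrite comulM; apply: tens_setM.
- move=> x; move: x; apply: gen_min => //.
  apply: subalgebraI.
  + apply: subspaceI => [|a x y hx hy] /=; first by rewrite linear0; exact: subspace0 sG'.
    by rewrite linearP; exact: subspaceP sG' hx hy.
  + by rewrite /= antipode1.
  + by move=> x y /= hx hy; rewrite antipodeM; apply: GM.
Qed.

Lemma grouplike_inv g : grouplike H g -> S g * g = 1 /\ g * S g = 1.
Proof.
move=> [cg eg]; split.
  have := antipode_sweedlerl g; rewrite eg scale1r /sweedler cg tens_liftE //.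
  split=> [w|v] a y z /=; first by rewrite linearP mulrDl -scalerAl.
  by rewrite mulrDr -scalerAr.
have := antipode_sweedlerr g; rewrite eg scale1r /sweedler cg tens_liftE //.
split=> [w|v] a y z /=; first by rewrite mulrDl -scalerAl.
by rewrite linearP mulrDr -scalerAr.
Qed.

(** Both [comul (S g)] and S g ⊗ S g are inverse to g ⊗ g. *)
Lemma grouplike_antipode g : grouplike H g -> grouplike H (S g).
Proof.
move=> gg; have [Sg gS] := grouplike_inv gg; have [cg eg] := gg; split.
  have inv : (S g ⊗t S g) * comul g = 1 :> H ⊗ H by rewrite cg tensM Sg.
  have inv' : comul g * comul (S g) = 1 :> H ⊗ H by rewrite -comulM gS comul1.
  by rewrite -[LHS]mul1r -inv -mulrA inv' mulr1.
by rewrite -[LHS]mul1r -eg -counitM gS counit1.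
Qed.

Lemma antipodeK_grouplike g : grouplike H g -> S (S g) = g.
Proof.
move=> gg; have [Sg gS] := grouplike_inv gg.
have [SSg _] := grouplike_inv (grouplike_antipode gg).
by rewrite -[LHS]mulr1 -Sg mulrA SSg mul1r.
Qed.

End HopfTheory.

(** * Module retractions onto Hopf subalgebras *)

Section Retraction.
Variables (k : fieldType) (H : hopfAlgType k).
Implicit Types (K L N Y : set H) (x g : H).

Local Notation S := (antipode : H -> H).

Definition stable K N : Prop := forall c x, K c -> N x -> N (c * x).

Lemma subcoalgebra_lcoideal K : subcoalgebra K -> lcoideal K.
Proof. by move=> /subcoalgebraP[]. Qed.

Lemma scalar_mulr (f : H -> k) g : scalar f -> scalar (fun a => f (a * g)).
Proof. by move=> fs c u v; rewrite mulrDl -scalerAl fs. Qed.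
Lemma scalar_mull (f : H -> k) g : scalar f -> scalar (fun a => f (g * a)).
Proof. by move=> fs c u v; rewrite mulrDr -scalerAr fs. Qed.

(** The hypothesis says [comul x] = g ⊗ x modulo H ⊗ N; multiplying by [comul c] gives
    [comul (c * x)] = c_1 g ⊗ c_2 x modulo H ⊗ N. *)
Lemma lhit_mul_socle K N x g f c : subcoalgebra K -> lcoideal N -> stable K N ->
  (forall f, scalar f -> N (lhit f x - f g *: x)) -> scalar f -> K c ->
  N (lhit f (c * x) - lhit (fun a => f (a * g)) c * x).
Proof.
move=> cK lN KN Nx fs Kc.
pose F a b := b * (lhit (fun z => f (a * z)) x - f (a * g) *: x).
have -> : lhit f (c * x) - lhit (fun a => f (a * g)) c * x = sweedler F c.
  have -> : sweedler F c =
      sweedler (fun a b => (-1) *: (f (a * g) *: b * x) +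
                           b * lhit (fun z => f (a * z)) x) c.
    by apply: eq_sweedler => a b; rewrite /F mulrBr -scalerAr scalerAl addrC scaleN1r.
  rewrite sweedlerP scaleN1r [RHS]addrC !lhitE sweedler_mulr; congr (_ - _).
  rewrite sweedlerM.
  - apply: eq_sweedler => a b; rewrite lhitE sweedler_mull.
    by apply: eq_sweedler => a' b'; rewrite scalerAr.
  - by move=> b; apply: linear_scaled.
  - by move=> a d u v; rewrite scalerDr !scalerA mulrC.
have [s sKK cE] := cK.2 _ Kc.
rewrite (sweedler_sum _ _ cE).
- apply: subspace_sum => [|p /sKK[K1 K2]]; first exact: lN.1.
  by apply: KN => //; apply: Nx; apply: scalar_mull.
- move=> b d u v; rewrite /F.
  have -> : lhit (fun z => f ((d *: u + v) * z)) x =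
      d *: lhit (fun z => f (u * z)) x + lhit (fun z => f (v * z)) x.
    rewrite -lhitDf !lhitE; apply: eq_sweedler => p q.
    by rewrite mulrDl -scalerAl fs.
  rewrite mulrDl -scalerAl fs [in LHS]scalerDl opprD addrACA mulrDr -scalerA.
  by rewrite -scalerBr -scalerAr.
- by move=> a d u v; rewrite /F mulrDl -scalerAl.
Qed.

(* N + Kx is free over K modulo N: the annihilator of x modulo N is a left    *)
(* ideal and a left coideal of K, hence contains S(c_1) c_2 = counit c.       *)
Lemma socle_free K N x g c : hopf_subalgebra K -> lcoideal N -> stable K N ->
  ~ N x -> grouplike H g -> (forall f, scalar f -> N (lhit f x - f g *: x)) ->
  K c -> N (c * x) -> c = 0.
Proof.
move=> [/subalgebraP[sK K1 KM] cK KS] lN KN Nx gg Nxg Kc Ncx.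
have [lK rK] := (subcoalgebraP K).1 cK.
have [Sg gS] := grouplike_inv gg.
pose I := [set d | K d /\ N (d * x)].
have lI : lcoideal I.
  split.
    apply: subspaceI => [|a u v [Ku Nu] [Kv Nv]].
      by split; rewrite ?mul0r; [exact: subspace0|exact: subspace0 lN.1].
    split; first exact: subspaceP.
    by rewrite mulrDl -scalerAl; apply: subspaceP => //; exact: lN.1.
  move=> f d fs [Kd Nd]; split; first exact: lK.2.
  (* Twisting f by S g cancels the factor g that [lhit_mul_socle] introduces. *)
  have fs' : scalar (fun a => f (a * S g)) by apply: scalar_mulr.
  have := lhit_mul_socle cK lN KN Nxg fs' Kd.
  have -> : lhit (fun a => f (a * g * S g)) d = lhit f d.
    by rewrite !lhitE; apply: eq_sweedler => a b; rewrite -mulrA gS mulr1.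
  move=> Nsub; rewrite -[_ * x](subKr (lhit (fun a => f (a * S g)) (d * x))).
  by apply: subspaceB => //; [exact: lN.1|apply: lN.2].
apply: contrapT => c0.
have [f [fs _ f1]] : exists f : H -> k,
    [/\ scalar f, forall u, [set 0] u -> f u = 0 & f c = 1].
  apply: functional_separation => //.
  by apply: subspaceI => // a u v -> ->; rewrite scaler0 addr0.
(* Since f(c) = 1, the element d = [lhit f c] of I has counit 1. Hence x = S(d_1) (d_2 x) with d_2
   in I, which lies in N. *)
have Ic : I (lhit f c) by apply: lI.2.
have ec : counit (lhit f c) = 1 :> k.
  by rewrite -scalar_rhitE ?rhit_counit //; apply: scalar_counit.
have : tens_set K I (comul (lhit f c)).
  apply: tens_set_slices => //; first exact: lI.1.
    by move=> e es; apply: lI.2.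
  by move=> e es; apply: rK => //; case: Ic.
move=> [s sKI cE]; apply: Nx.
have := antipode_sweedlerl (lhit f c); rewrite ec scale1r.
rewrite (sweedler_sum _ _ cE).
- move=> e; rewrite -[x]mul1r -e mulr_suml.
  apply: subspace_sum => [|p /sKI[Kp [_ Np]]]; first exact: lN.1.
  by rewrite -mulrA; apply: KN => //; apply: KS.
- by move=> b a u v; rewrite linearP mulrDl -scalerAl.
- by move=> b a u v; rewrite mulrDr -scalerAr.
Qed.

Definition addset K Y : set H := [set h | exists2 c, K c & Y (h - c)].

Lemma subspace_addset K Y : subspace K -> subspace Y -> subspace (addset K Y).
Proof.
move=> sK sY; apply: subspaceI.
  by exists 0; rewrite ?subr0; exact: subspace0.
move=> a x y [c Kc Yc] [d Kd Yd]; exists (a *: c + d); first exact: subspaceP.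
by rewrite opprD addrACA -scalerBr; apply: subspaceP.
Qed.

(** The coideal condition on K + Y is what lets [pointed_socle] and [socle_free] be applied with N =
    K + Y. *)
Definition partial_complement K Y : Prop :=
  [/\ subspace Y, stable K Y, forall x, K x -> Y x -> x = 0 & lcoideal (addset K Y)].

Lemma partial_complement0 K : hopf_subalgebra K -> partial_complement K [set 0].
Proof.
move=> [/subalgebraP[sK K1 KM] cK KS].
split=> //.
- by apply: subspaceI => // a u v -> ->; rewrite scaler0 addr0.
- by move=> c x _ ->; rewrite mulr0.
- suff -> : addset K [set 0] = K by apply: subcoalgebra_lcoideal.
  rewrite eqEsubset; split=> [h [c Kc /eqP]|h Kh].
    by rewrite subr_eq0 => /eqP->.
  by exists h => //; rewrite subrr.
Qed.

(** The new module is Y + Kx, for x a socle vector modulo K + Y. An element of K of the form y + cx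
    puts cx in K + Y, so c = 0 by freeness and the sum with K stays direct. *)
Lemma partial_complement_extend K Y : pointed H -> hopf_subalgebra K ->
  partial_complement K Y -> ~ [set: H] `<=` addset K Y ->
  exists2 Y', partial_complement K Y' & Y `<` Y'.
Proof.
move=> ptd hK [sY KY KY0 lN] nT.
have [/subalgebraP[sK K1 KM] cK KS] := hK.
have KN : stable K (addset K Y).
  move=> c h Kc [d Kd Yd]; exists (c * d); first exact: KM.
  by rewrite -mulrBr; apply: KY.
have cT : subcoalgebra [set: H].
  by apply/subcoalgebraP; split=> //; split=> //; apply: subspaceI.
have [x [g [_ Nx _ gg Nxg]]] :=
  pointed_socle ptd (subcoalgebra_lcoideal cT) lN cT (@subset_refl _ _) nT.
have free c := socle_free hK lN KN Nx gg Nxg (c := c).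
have YN : Y `<=` addset K Y by move=> y Yy; exists 0; [exact: subspace0|rewrite subr0].
pose Y' := [set z | exists2 c, K c & Y (z - c * x)].
have sY' : subspace Y'.
  apply: subspaceI; first by exists 0; rewrite ?mul0r ?subr0; exact: subspace0.
  move=> a u v [c Kc Yc] [d Kd Yd]; exists (a *: c + d); first exact: subspaceP.
  by rewrite mulrDl -scalerAl opprD addrACA -scalerBr; apply: subspaceP.
have YY' : Y `<=` Y' by move=> y Yy; exists 0; [exact: subspace0|rewrite mul0r subr0].
exists Y'; last first.
  split=> // Y'Y; apply: Nx; apply: YN; apply: Y'Y; exists 1 => //.
  by rewrite mul1r subrr; apply: subspace0.
split=> //.
- move=> c z Kc [d Kd Yd]; exists (c * d); first exact: KM.
  by rewrite -mulrA -mulrBr; apply: KY.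
- move=> z Kz [c Kc Yz].
  have c0 : c = 0.
    apply: free => //; exists z => //; rewrite -opprB; exact: subspaceN.
  by apply: KY0 => //; move: Yz; rewrite c0 mul0r subr0.
have NN' : addset K Y `<=` addset K Y' by move=> h [c Kc /YY' Yc]; exists c.
have sN' := subspace_addset sK sY'.
split=> // f h fs [c Kc [d Kd Yh]].
have Kx e : K e -> addset K Y' (e * x).
  move=> Ke; exists 0; first exact: subspace0.
  exists e => //; rewrite subr0 subrr; exact: subspace0.
have [_ lD _ _] := lin_morph (lhit_linear fs).
rewrite -(subrK (d * x) h) lD; apply: subspaceD => //.
  apply: NN'; apply: lN.2 => //; exists c => //; by rewrite addrAC.
rewrite -(subrK (lhit (fun a => f (a * g)) d * x) (lhit f (d * x))).
apply: subspaceD => //.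
  by apply: NN'; apply: lhit_mul_socle cK lN KN Nxg fs Kd.
apply: Kx; apply: (subcoalgebra_lcoideal cK).2 => //; exact: scalar_mulr.
Qed.

Lemma complement_exists K : pointed H -> hopf_subalgebra K ->
  exists Y, [/\ subspace Y, stable K Y, forall x, K x -> Y x -> x = 0 &
    [set: H] `<=` addset K Y].
Proof.
move=> ptd hK; have [/subalgebraP[sK K1 KM] cK KS] := hK.
pose P := [set Y | Y = set0 \/ partial_complement K Y].
have [Y [PY maxY]] : exists Y, P Y /\ forall B, Y `<` B -> ~ P B.
  apply: Zorn_bigcup => F FP tot.
  have [[X FX [x Xx]]|F0] := pselect (exists2 X, F X & X !=set0); last first.
    left; rewrite -subset0 => y [X FX Xy]; case: F0; exists X => //.
    by exists y.
  have nz Y y : F Y -> Y y -> partial_complement K Y.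
    by move=> FY Yy; case: (FP _ FY) => [Y0|//]; move: Yy; rewrite Y0.
  have pX := nz _ _ FX Xx.
  have sU : subspace (\bigcup_(Y in F) Y).
    apply: subspaceI; first by exists X => //; case: pX => /subspace0.
    move=> a y z [Y FY Yy] [Z FZ Zz].
    have [sY _ _ _] := nz _ _ FY Yy; have [sZ _ _ _] := nz _ _ FZ Zz.
    by case: (tot _ _ FY FZ) => YZ; [exists Z|exists Y] => //;
       apply: subspaceP => //; apply: YZ.
  right; split=> //.
  - move=> c y Kc [Y FY Yy]; exists Y => //.
    by have [_ KY _ _] := nz _ _ FY Yy; apply: KY.
  - by move=> y Ky [Y FY Yy]; have [_ _ + _] := nz _ _ FY Yy; apply.
  split; first exact: subspace_addset.
  move=> f h fs [c Kc [Y FY Yh]].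
  have [_ _ _ [_ lY]] := nz _ _ FY Yh.
  have [d Kd Yd] : addset K Y (lhit f h) by apply: lY => //; exists c.
  by exists d => //; exists Y.
have pY : partial_complement K Y.
  case: PY => // Y0; case: (maxY [set 0]); last first.
    by right; apply: partial_complement0.
  by rewrite Y0; split=> // /(_ 0); apply.
exists Y; have [sY KY KY0 lN] := pY; split=> //.
apply: contrapT => nT.
have [Y' pY' YY'] := partial_complement_extend ptd hK pY nT.
by apply: maxY YY' _; right.
Qed.

Lemma retraction_exists K : pointed H -> hopf_subalgebra K ->
  exists phi : H -> H, [/\ linear phi, forall h, K (phi h),
    forall c h, K c -> phi (c * h) = c * phi h & forall c, K c -> phi c = c].
Proof.
move=> ptd hK; have [/subalgebraP[sK K1 KM] cK KS] := hK.
have [Y [sY KY KY0 KYT]] := complement_exists ptd hK.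
have /choice[phi phiP] : forall h, exists c, K c /\ Y (h - c).
  by move=> h; have [c Kc Yc] := KYT h I; exists c.
have uniq_phi h c : K c -> Y (h - c) -> phi h = c.
  have [Kp Yp] := phiP h.
  move=> Kc Yc; apply/eqP; rewrite -subr_eq0; apply/eqP; apply: KY0.
    exact: subspaceB.
  have := subspaceB sY Yc Yp.
  by rewrite opprB [X in Y X]addrC addrA subrK.
exists phi; split=> [a x y|h|c h Kc|c Kc].
- have [Kx Yx] := phiP x; have [Ky Yy] := phiP y.
  apply: uniq_phi; first exact: subspaceP.
  by rewrite opprD addrACA -scalerBr; apply: subspaceP.
- by case: (phiP h).
- have [Kh Yh] := phiP h; apply: uniq_phi; first exact: KM.
  by rewrite -mulrBr; apply: KY.
- by apply: uniq_phi => //; rewrite subrr; apply: subspace0.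
Qed.

(* K^+ H, for K^+ the augmentation ideal of K.                                *)
Definition aug K : set H := [set z | exists2 s : seq (H * H),
  (forall p, p \in s -> K p.1 /\ counit p.1 = 0 :> k) &
  z = \sum_(p <- s) p.1 * p.2].

Lemma aug_right_ideal K : subspace K -> right_ideal (aug K).
Proof.
move=> sK; split; last first.
  move=> a _ [s sP ->]; exists [seq (p.1, p.2 * a) | p <- s].
    by move=> _ /mapP[p ps ->]; exact: (sP p ps).
  by rewrite mulr_suml big_map; apply: eq_bigr => p _; rewrite mulrA.
split; first by apply/mem_set; exists [::]; rewrite ?big_nil.
move=> _ _ /set_mem[s sP ->] /set_mem[t tP ->]; apply/mem_set.
exists (s ++ [seq (p.1, - p.2) | p <- t]).
  by move=> p; rewrite mem_cat => /orP[/sP//|/mapP[q /tP tq ->]].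
rewrite big_cat big_map -sumrN; congr (_ + _).
by apply: eq_bigr => p _; rewrite mulrN.
Qed.

Lemma aug_mono K L : K `<=` L -> aug K `<=` aug L.
Proof. by move=> KL _ [s sP ->]; exists s => // p /sP[/KL]. Qed.

Lemma mem_aug K x : K x -> counit x = 0 :> k -> aug K x.
Proof.
move=> Kx ex; exists [:: (x, 1)]; last by rewrite big_seq1 mulr1.
by move=> p; rewrite inE => /eqP->.
Qed.

Lemma sub_of_aug K L : pointed H -> hopf_subalgebra K -> hopf_subalgebra L ->
  aug L `<=` aug K -> L `<=` K.
Proof.
move=> ptd hK hL LK l Ll.
have [/subalgebraP[sK K1 KM] cK KS] := hK.
have [/subalgebraP[sL L1 LM] cL LS] := hL.
have [phi [phil phiK phiM phi_id]] := retraction_exists ptd hK.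
pose F (a b : H) := S a * phi b.
have Fl b : linear (F^~ b) by move=> a u v; rewrite /F linearP mulrDl -scalerAl.
have Fr a : linear (F a) by move=> c u v; rewrite /F phil mulrDr -scalerAr.
pose theta h := sweedler F h.
have thl : linear theta by apply: sweedler_linear.
have [th0 thD thB thZ] := lin_morph thl.
(* S(c_1 h_1) phi(c_2 h_2) = S(h_1) S(c_1) c_2 phi(h_2) by K-linearity of phi. *)
have thM c h : K c -> theta (c * h) = counit c *: theta h.
  move=> Kc; have [s sKK cE] := cK.2 _ Kc.
  have [t _ hE] : tens_set [set: H] [set: H] (comul h).
    by exists (repr (comul h)) => //; apply: tens_sumE.
  rewrite /theta sweedlerM //.
  pose G a b := sweedler (fun d e => F (a * d) (b * e)) h.
  rewrite (@sweedler_sum _ _ _ G _ _ _ _ cE); last 2 first.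
  - move=> b a u v; rewrite /G -sweedlerP; apply: eq_sweedler => d e.
    by rewrite mulrDl -scalerAl Fl.
  - move=> b a u v; rewrite /G -sweedlerP; apply: eq_sweedler => d e.
    by rewrite mulrDl -scalerAl Fr.
  transitivity (sweedler (fun d e => S d * (counit c)%:A * phi e) h).
    rewrite -antipode_sweedlerl (sweedler_sum _ _ cE); last 2 first.
    - by move=> b a u v; rewrite linearP mulrDl -scalerAl.
    - by move=> b a u v; rewrite mulrDr -scalerAr.
    rewrite /sweedler /tens_lift.
    under [RHS]eq_bigr => q _ do rewrite mulr_sumr mulr_suml.
    rewrite [RHS]exchange_big /=; apply: eq_big_seq => p /sKK[_ Kp2].
    rewrite /G /sweedler /tens_lift; apply: eq_bigr => q _.
    by rewrite /F antipodeM phiM // !mulrA.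
  rewrite scaler_sweedler; apply: eq_sweedler => d e.
  by rewrite -scalerAr mulr1 scalerAl.
have thaug z : aug K z -> theta z = 0.
  move=> [s sP ->]; rewrite (lin_sum _ _ thl) big_seq big1 // => p /sP[Kp ep].
  by rewrite thM // ep scale0r.
have th1 : theta 1 = 1.
  rewrite /theta (@sweedler_sum _ _ _ F [:: (1, 1)]) //.
    by rewrite big_seq1 /F antipode1 phi_id // mulr1.
  by rewrite comul1 big_seq1.
(* h - counit(h) 1 lies in L^+, hence in K^+ H, where theta vanishes. *)
have thL h : L h -> theta h = (counit h)%:A.
  move=> Lh; apply/eqP; rewrite -th1 -thZ -subr_eq0 -thB; apply/eqP.
  apply: thaug; apply: LK; apply: mem_aug; first exact: subspaceB sL Lh (subspaceZ _ sL L1).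
  rewrite linearB; have -> := scalarZ (counit h) (1 : H) (@scalar_counit _ _).
  by rewrite counit1 mulr1 subrr.
suff <- : phi l = l by [].
(* Insert l_1 S(l_2) in front of phi(l_3). *)
have -> : phi l = sweedler (fun a b => a * theta b) l.
  transitivity (sweedler (fun a b => sweedler (fun c d => a * S c * phi d) b) l).
    rewrite -(@sweedlerA _ _ _ (fun a b c => a * S b * phi c)).
    - rewrite -{1}[l]lhit_counit (lin_lhit _ _ phil).
      apply: eq_sweedler => a b.
      by rewrite -sweedler_mulr antipode_sweedlerr -scalerAl mul1r.
    - by move=> b c a u v; rewrite !mulrDl -!scalerAl.
    - by move=> b c a u v; rewrite linearP mulrDr mulrDl -scalerAr -scalerAl.
    - by move=> b c a u v; rewrite phil mulrDr -scalerAr.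
  apply: eq_sweedler => a b; rewrite sweedler_mull.
  by apply: eq_sweedler => c d; rewrite mulrA.
have [s sL' lE] := cL.2 _ Ll.
rewrite (sweedler_sum _ _ lE); last 2 first.
- by move=> b a u v; rewrite mulrDl -scalerAl.
- by move=> b a u v; rewrite thl mulrDr -scalerAr.
rewrite -[RHS]rhit_counit rhitE (sweedler_sum _ _ lE); last 2 first.
- by move=> b a u v; rewrite scalerDr !scalerA mulrC.
- by move=> b; apply: linear_scaled; apply: scalar_counit.
apply: eq_big_seq => p /sL'[_ Lp].
by rewrite thL // -scalerAr mulr1.
Qed.

Lemma right_noetherian_acc : pointed H -> right_noetherian H ->
  acc (@hopf_subalgebra k H).
Proof.
move=> ptd noeth A hA Amono.
have le_mono m n : (m <= n)%N -> A m `<=` A n.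
  move=> /subnK<-; elim: (n - m)%N => [//|i IHi]; rewrite addSn.
  exact: subset_trans IHi (Amono _).
have [n|n|N stab] := noeth (fun n => aug (A n)).
- by apply: aug_right_ideal; have [/subalgebraP[]] := hA n.
- exact: aug_mono.
exists N => n Nn; rewrite eqEsubset; split; last exact: le_mono.
by apply: sub_of_aug => //; rewrite stab.
Qed.

End Retraction.

(** * The opposite Hopf algebra *)

Section Swap.
Variables (k : fieldType).
Implicit Types (U V W : lmodType k).

Definition tens_swap V W : V ⊗ W -> W ⊗ V := tens_lift (fun v w => w ⊗t v).

Lemma tens_swap_bil V W :
  bilinear_for *:%R *:%R (fun (v : V) (w : W) => w ⊗t v : W ⊗ V).
Proof.
by split=> [w a x y|v a x y] /=; rewrite ?tensDl ?tensDr ?tensZl ?tensZr.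
Qed.

Lemma tens_swap_linear V W : linear (@tens_swap V W).
Proof. exact: tens_lift_linear (@tens_swap_bil V W). Qed.

Lemma tens_swapE V W (v : V) (w : W) : tens_swap (v ⊗t w) = w ⊗t v.
Proof. exact: tens_liftE (@tens_swap_bil V W) _ _. Qed.

Lemma tens_swapK V W : cancel (@tens_swap V W) (@tens_swap W V).
Proof.
apply: (@tens_linear_ext k V W _ (fun t => tens_swap (tens_swap t)) id) => //.
  by move=> a x y; rewrite !tens_swap_linear.
by move=> v w; rewrite !tens_swapE.
Qed.

Lemma tens_map_linear V V' W W' (f : {linear V -> V'}) (g : {linear W -> W'}) :
  linear (tens_map f g).
Proof.
apply: tens_lift_linear; split=> [w a x y|v a x y] /=; rewrite linearP.
  by rewrite tensDl tensZl.
by rewrite tensDr tensZr.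
Qed.

End Swap.

Section Opposite.
Variables (k : fieldType) (H : hopfAlgType k).

(** Both structures are reversed at once so that the same map remains the antipode; reversing only
    one would call for its inverse. *)
Definition opcop : Type := H.

HB.instance Definition _ := GRing.NzRing.copy opcop (H^c).
HB.instance Definition _ := GRing.Lmodule.copy opcop H.

(* Without the cast to opcop the product would be elaborated in H.            *)
Lemma opcop_scalerAl (a : k) (x y : opcop) : a *: (x * y) = (a *: x : opcop) * y.
Proof. exact: (@scalerAr k H a y x). Qed.
HB.instance Definition _ := GRing.Lmodule_isLalgebra.Build k opcop opcop_scalerAl.

Lemma opcop_scalerAr (a : k) (x y : opcop) : a *: (x * y) = x * (a *: y : opcop).
Proof. exact: (@scalerAl k H a y x). Qed.
HB.instance Definition _ := GRing.Lalgebra_isAlgebra.Build k opcop opcop_scalerAr.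

Definition opcop_comul (x : opcop) : opcop ⊗ opcop :=
  tens_swap (comul (x : H)).

Lemma opcop_comul_linear : linear opcop_comul.
Proof. by move=> a x y; rewrite /opcop_comul linearP tens_swap_linear. Qed.
HB.instance Definition _ := GRing.isLinear.Build k opcop (opcop ⊗ opcop)%type _
  opcop_comul opcop_comul_linear.

Definition opcop_counit (x : opcop) : k := counit (x : H).
Lemma opcop_counit_scalar : scalar opcop_counit.
Proof. by move=> a x y; rewrite /opcop_counit linearP. Qed.
HB.instance Definition _ := GRing.isLinear.Build k opcop k _
  opcop_counit opcop_counit_scalar.

Lemma opcop_comulE x :
  opcop_comul x = sweedler (fun a b : H => (b : opcop) ⊗t (a : opcop)) x.
Proof. by []. Qed.

Lemma tens_lift_opcop (U : lmodType k) (F : opcop -> opcop -> U) x :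
  (forall b, linear (F^~ b)) -> (forall a, linear (F a)) ->
  tens_lift F (opcop_comul x) = sweedler (fun a b : H => F b a) x.
Proof.
move=> Fl Fr; have Fb : bilinear_for *:%R *:%R F by split.
rewrite opcop_comulE (lin_sweedler _ _ (tens_lift_linear Fb)).
by apply: eq_sweedler => a b; rewrite (tens_liftE Fb).
Qed.

Lemma opcop_comulA x :
  tens_assoc (tens_map opcop_comul idfun (opcop_comul x)) =
  tens_map idfun opcop_comul (opcop_comul x).
Proof.
pose F (a b c : H) : opcop ⊗ (opcop ⊗ opcop) := (c : opcop) ⊗t ((b : opcop) ⊗t (a : opcop)).
transitivity (sweedler (fun a b => sweedler (fun c d => F a c d) b) x).
  rewrite [opcop_comul x]opcop_comulE.
  rewrite (lin_sweedler _ _ (tens_map_linear opcop_comul idfun)).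
  rewrite (lin_sweedler _ _ (@tens_assoc_linear k opcop opcop opcop)).
  apply: eq_sweedler => a b; rewrite tens_mapE.
  transitivity (tens_assoc (sweedler (fun c d : H => (d : opcop) ⊗t (c : opcop)) b
    ⊗t (a : opcop))); first by [].
  rewrite (@lin_sweedler _ _ _ _ (fun t => tens_assoc (t ⊗t (a : opcop)))).
    by apply: eq_sweedler => c d; rewrite tens_assocE.
  by move=> c u v; rewrite tensDl tensZl tens_assoc_linear.
rewrite -sweedlerA.
- rewrite [opcop_comul x]opcop_comulE.
  rewrite (lin_sweedler _ _ (tens_map_linear idfun opcop_comul)).
  apply: eq_sweedler => a b; rewrite tens_mapE.
  transitivity ((b : opcop) ⊗t
    sweedler (fun c d : H => (d : opcop) ⊗t (c : opcop)) a); last by [].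
  rewrite (@lin_sweedler _ _ _ _ (fun t => (b : opcop) ⊗t t)) //.
  by move=> c u v; rewrite tensDr tensZr.
- by move=> b c a u v; rewrite /F !tensDr !tensZr.
- by move=> b c a u v; rewrite /F tensDl tensDr tensZl tensZr.
- by move=> b c a u v; rewrite /F tensDl tensZl.
Qed.

Lemma opcop_counitl x :
  tens_lift (fun y z => opcop_counit y *: z) (opcop_comul x) = x.
Proof.
rewrite tens_lift_opcop.
- exact: rhit_counit.
- by move=> b; apply: linear_scaled; apply: opcop_counit_scalar.
- by move=> b a u v; rewrite scalerDr !scalerA mulrC.
Qed.

Lemma opcop_counitr x :
  tens_lift (fun y z => opcop_counit z *: y) (opcop_comul x) = x.
Proof.
rewrite tens_lift_opcop.
- exact: lhit_counit.
- by move=> b a u v; rewrite scalerDr !scalerA mulrC.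
- by move=> b; apply: linear_scaled; apply: opcop_counit_scalar.
Qed.

HB.instance Definition _ := isCoalgebra.Build k opcop
  opcop_comulA opcop_counitl opcop_counitr.

Lemma opcop_comul_monoid :
  monoid_morphism (comul : opcop -> opcop ⊗ opcop).
Proof.
split.
  rewrite -[comul _]/(tens_swap (comul (1 : H))) comul1; exact: tens_swapE.
move=> x y; rewrite -[LHS]/(opcop_comul ((y : H) * (x : H))).
rewrite -[RHS]/(opcop_comul x * opcop_comul y) !opcop_comulE.
rewrite sweedlerM; last 2 first.
- by move=> b a u v; rewrite tensDr tensZr.
- by move=> b a u v; rewrite tensDl tensZl.
rewrite {3 4}/sweedler /tens_lift mulr_suml /=.
under [RHS]eq_bigr => p _ do rewrite mulr_sumr.
rewrite exchange_big /=; apply: eq_bigr => q _.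
rewrite /sweedler /tens_lift; apply: eq_bigr => p _.
by rewrite [RHS]tens_mulE.
Qed.

Lemma opcop_counit_monoid : monoid_morphism (counit : opcop -> k).
Proof.
split; first exact: counit1.
by move=> x y; rewrite mulrC; apply: (@counitM k H y x).
Qed.

HB.instance Definition _ := isBialgebra.Build k opcop
  opcop_comul_monoid opcop_counit_monoid.

Definition opcop_antipode (x : opcop) : opcop := antipode (x : H).
Lemma opcop_antipode_linear : linear opcop_antipode.
Proof. by move=> a x y; rewrite /opcop_antipode linearP. Qed.
HB.instance Definition _ := GRing.isLinear.Build k opcop opcop _
  opcop_antipode opcop_antipode_linear.

Lemma opcop_antipodel (x : opcop) :
  tens_lift (fun y z => opcop_antipode y * z) (comul x) = (counit x)%:A.
Proof.
rewrite -[LHS]/(tens_lift (fun y z : opcop => opcop_antipode y * z)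
  (opcop_comul x)) tens_lift_opcop.
- exact: antipode_sweedlerr.
- by move=> b a u v; rewrite opcop_antipode_linear mulrDl scalerAl.
- by move=> b a u v; rewrite mulrDr scalerAr.
Qed.

Lemma opcop_antipoder (x : opcop) :
  tens_lift (fun y z => y * opcop_antipode z) (comul x) = (counit x)%:A.
Proof.
rewrite -[LHS]/(tens_lift (fun y z : opcop => y * opcop_antipode z)
  (opcop_comul x)) tens_lift_opcop.
- exact: antipode_sweedlerl.
- by move=> b a u v; rewrite mulrDl scalerAl.
- by move=> b a u v; rewrite opcop_antipode_linear mulrDr scalerAr.
Qed.

HB.instance Definition _ := hasAntipode.Build k opcop
  opcop_antipodel opcop_antipoder.

Lemma lhit_opcop (f : H -> k) x : scalar f -> @lhit k opcop f x = @rhit k H f x.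
Proof.
move=> fs; transitivity (tens_lift (fun y z : opcop => f y *: z) (opcop_comul x)).
  reflexivity.
rewrite tens_lift_opcop //.
- by move=> b; apply: linear_scaled.
- by move=> b a u v; rewrite scalerDr !scalerA mulrC.
Qed.

Lemma rhit_opcop (f : H -> k) x : scalar f -> @rhit k opcop f x = @lhit k H f x.
Proof.
move=> fs; transitivity (tens_lift (fun y z : opcop => f z *: y) (opcop_comul x)).
  reflexivity.
rewrite tens_lift_opcop //.
- by move=> b a u v; rewrite scalerDr !scalerA mulrC.
- by move=> b; apply: linear_scaled.
Qed.

(** Reversing the coproduct exchanges the two actions of functionals, and subcoalgebras are stable
    under both. *)
Lemma subcoalgebra_opcop : @subcoalgebra k opcop = @subcoalgebra k H.
Proof.
apply/funext => D; apply/propext; split=> /subcoalgebraP[[sD lD] rD];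
  apply/subcoalgebraP; split; [split=> //| |split=> //|] => f x fs Dx.
- by rewrite -rhit_opcop //; apply: rD.
- by rewrite -lhit_opcop //; apply: lD.
- by rewrite lhit_opcop //; apply: rD.
- by rewrite rhit_opcop //; apply: lD.
Qed.

Lemma grouplike_opcop : grouplike opcop = grouplike H.
Proof.
rewrite eqEsubset; split=> g [cg eg]; split=> //.
  have /(congr1 (@tens_swap k H H)) : tens_swap (comul (g : H)) = (g : H) ⊗t (g : H) := cg.
  by rewrite tens_swapK tens_swapE.
by rewrite [LHS]/(tens_swap (comul (g : H))) cg; apply: tens_swapE.
Qed.

Lemma pointed_opcop : pointed H -> pointed opcop.
Proof.
rewrite /pointed /coradical /simple_subcoalgebra grouplike_opcop subcoalgebra_opcop.
by [].
Qed.

Lemma hopf_subalgebra_opcop : @hopf_subalgebra k opcop = @hopf_subalgebra k H.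
Proof.
apply/funext => K; apply/propext; rewrite /hopf_subalgebra subcoalgebra_opcop.
by split=> -[/subalgebraP[sK K1 KM] cK KS]; split=> //; apply: subalgebraI => //;
  move=> x y Kx Ky; apply: KM.
Qed.

Lemma right_noetherian_opcop : left_noetherian H -> right_noetherian opcop.
Proof. by move=> noeth I hI; apply: noeth. Qed.

Lemma left_noetherian_acc : pointed H -> left_noetherian H ->
  acc (@hopf_subalgebra k H).
Proof.
move=> ptd noeth; rewrite -hopf_subalgebra_opcop.
exact: (@right_noetherian_acc k opcop (pointed_opcop ptd) (right_noetherian_opcop noeth)).
Qed.

End Opposite.

(** * Affineness *)

Section Affine.
Variables (k : fieldType) (H : hopfAlgType k).
Implicit Types (A K : set H) (s r : seq H).

Local Notation S := (antipode : H -> H).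

Lemma tens_set_mono A K : A `<=` K -> tens_set A A `<=` tens_set K K.
Proof. by move=> AK t [s sP ->]; exists s => // p /sP[/AK ? /AK]. Qed.

Lemma mem_gen s x : x \in s -> gen [set` s] x.
Proof. exact: sub_gen. Qed.

Lemma adjoin_hopf A s r : A = gen [set` s] -> hopf_subalgebra A ->
  (forall x, x \in r -> let B := gen [set` r ++ s] in
     tens_set B B (comul x) /\ B (S x)) ->
  hopf_subalgebra (gen [set` r ++ s]) /\ A `<=` gen [set` r ++ s].
Proof.
move=> AE hA rB; set B := gen _.
have AB : A `<=` B.
  rewrite AE; apply: gen_min; first exact: gen_subalgebra.
  by move=> x xs; apply: mem_gen; rewrite mem_cat [x \in s]xs orbT.
have sA x : x \in s -> A x by move=> xs; rewrite AE; apply: mem_gen.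
have [_ cA SA] := hA.
split=> //; apply: gen_hopf => x; rewrite /= mem_cat => /orP[/rB[]//|/sA Ax].
  by apply: tens_set_mono AB _ _; apply: cA.2.
by apply: AB; apply: SA.
Qed.

Lemma gen_hopf_sub A s K : A = gen [set` s] -> A `<=` K -> hopf_subalgebra K ->
  forall r, (forall x, x \in r -> K x) -> gen [set` r ++ s] `<=` K.
Proof.
move=> AE AK [sK _ _] r rK; apply: gen_min => // x /=.
by rewrite mem_cat => /orP[/rK//|xs]; apply: AK; rewrite AE; apply: mem_gen.
Qed.

(* The x in K with comul x = g ⊗ x modulo K ⊗ A form a right coideal, to      *)
(* which pointed_socle applies again on the other side.                       *)
Lemma skew_primitive_exists A K : pointed H -> hopf_subalgebra A ->
  hopf_subalgebra K -> ~ K `<=` A -> (forall g, K g -> grouplike H g -> A g) ->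
  exists x g h, [/\ K x, ~ A x, A g /\ grouplike H g, A h &
    tens_set A A (comul x - g ⊗t x - x ⊗t h)].
Proof.
move=> ptd hA hK KA gA.
have [/subalgebraP[sA A1 AM] cA SA] := hA.
have [/subalgebraP[sK K1 KM] cK SK] := hK.
have [lA rA] := (subcoalgebraP A).1 cA.
have [lK rK] := (subcoalgebraP K).1 cK.
have [x0 [g [Kx0 Ax0 Kg gg x0g]]] :=
  pointed_socle ptd lK lA cK (@subset_refl _ _) KA.
pose X := [set x | K x /\ forall f, scalar f -> A (lhit f x - f g *: x)].
have XK : X `<=` K by move=> x [].
have sX : subspace X.
  apply: subspaceI => [|a x y [Kx Xx] [Ky Xy]].
    split=> [|f fs]; first exact: subspace0.
    have [-> _ _ _] := lin_morph (lhit_linear fs).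
    by rewrite scaler0 subrr; apply: subspace0.
  split=> [|f fs]; first exact: subspaceP.
  rewrite lhit_linear // scalerDr scalerA mulrC -scalerA opprD addrACA -scalerBr.
  by apply: subspaceP => //; [apply: Xx|apply: Xy].
have lX : @lcoideal k (opcop H) X.
  split=> // f x fs [Kx Xx]; rewrite lhit_opcop //; split; first exact: rK.
  move=> e es; rewrite lhit_rhit //.
  have [_ _ rB rZ] := lin_morph (@rhit_linear k H f fs).
  by rewrite -rZ -rB; apply: rA => //; apply: Xx.
have cK' : @subcoalgebra k (opcop H) K by rewrite subcoalgebra_opcop.
have lA' : @lcoideal k (opcop H) A.
  by apply: subcoalgebra_lcoideal; rewrite subcoalgebra_opcop.
have XA : ~ X `<=` A by move=> XA; apply: Ax0; apply: XA; split.
have [x [h [[Kx Xx] Ax Kh gh xh]]] :=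
  @pointed_socle k (opcop H) X A K (pointed_opcop ptd) lX lA' cK' XK XA.
have {}gh : grouplike H h by rewrite -grouplike_opcop.
have Ag := gA _ Kg gg; have Ah := gA _ Kh gh.
exists x, g, h; split=> //.
(* A left slice is [lhit f x] - f(g) x - f(x) h and a right slice is [rhit f x] - f(x) g - f(h) x;
   each lies in A by the choice of x and because g and h do. *)
apply: tens_set_slices => // f fs.
  have [_ _ lB _] := lin_morph (@slicel_linear k H H f fs).
  rewrite !lB !slicelE //; apply: subspaceB => //; first exact: Xx.
  exact: subspaceZ.
have [_ _ rB _] := lin_morph (@slicer_linear k H H f fs).
rewrite !rB !slicerE // addrAC; apply: subspaceB => //; last exact: subspaceZ.
by have := xh f fs; rewrite lhit_opcop.
Qed.

(** If a group-like of K is missing from A, it is adjoined with its inverse. Otherwise a skew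
    primitive x modulo A ⊗ A is adjoined alone, and its antipode comes for free. *)
Lemma affine_extend A K : pointed H -> hopf_subalgebra A -> affine A ->
  hopf_subalgebra K -> A `<=` K -> ~ K `<=` A ->
  exists B, [/\ hopf_subalgebra B, affine B, A `<=` B, B `<=` K & ~ B `<=` A].
Proof.
move=> ptd hA [s AE] hK AK KA.
have [sA cA SA] := hA; have [sK cK SK] := hK.
have fin r : (forall x, x \in r -> K x) ->
    (forall x, x \in r -> let B := gen [set` r ++ s] in
       tens_set B B (comul x) /\ B (S x)) ->
    (exists2 x, x \in r & ~ A x) ->
    exists B, [/\ hopf_subalgebra B, affine B, A `<=` B, B `<=` K & ~ B `<=` A].
  move=> rK rB [x xr Ax]; have [hB AB] := adjoin_hopf AE hA rB.
  exists (gen [set` r ++ s]); split=> //; first by exists (r ++ s).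
    exact: gen_hopf_sub AE AK hK r rK.
  by move=> BA; apply: Ax; apply: BA; apply: mem_gen; rewrite mem_cat xr.
have [[g [Kg gg Ag]]|noG] :=
    pselect (exists g, [/\ K g, grouplike H g & ~ A g]).
  apply: (fin [:: g; S g]).
  - by move=> x; rewrite !inE => /orP[]/eqP-> //; apply: SK.
  - have gB x : x \in [:: g; S g] -> gen [set` [:: g; S g] ++ s] x.
      by move=> xr; apply: mem_gen; rewrite mem_cat xr.
    have Bg := gB g (mem_head _ _).
    have BSg : gen [set` [:: g; S g] ++ s] (S g) by apply: gB; rewrite !inE eqxx orbT.
    move=> x; rewrite !inE => /orP[]/eqP-> /=.
      by split=> //; case: gg => -> _; apply: tens_set_tens.
    rewrite antipodeK_grouplike //; split=> //.
    by have [-> _] := grouplike_antipode gg; apply: tens_set_tens.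
  - by exists g; rewrite ?mem_head.
have gA g : K g -> grouplike H g -> A g.
  by move=> Kg gg; apply: contrapT => Ag; apply: noG; exists g.
have [x [g [h [Kx Ax [Ag gg] Ah Axgh]]]] := skew_primitive_exists ptd hA hK KA gA.
have [t At cx] : exists2 t, tens_set A A t & comul x = t + x ⊗t h + g ⊗t x.
  by exists (comul x - g ⊗t x - x ⊗t h); rewrite ?subrK.
apply: (fin [:: x]).
- by move=> y; rewrite inE => /eqP->.
- move=> y; rewrite inE => /eqP-> B.
  have AB : A `<=` B.
    rewrite AE; apply: gen_min; first exact: gen_subalgebra.
    by move=> z zs; apply: mem_gen; rewrite inE [z \in s]zs orbT.
  have [sB B1 BM] := subalgebraP (gen_subalgebra [set` [:: x] ++ s]).
  have Bx : B x by apply: mem_gen; rewrite inE eqxx.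
  have Bt := tens_set_mono AB At.
  split.
    by rewrite cx; do 2?apply: tens_setD => //; apply: tens_set_tens => //; apply: AB.
  have bil : bilinear_for *:%R *:%R (fun a b : H => a * S b).
    split=> [w a u v|w a u v] /=; first by rewrite mulrDl -scalerAl.
    by rewrite linearP mulrDr -scalerAr.
  have [_ mD _ _] := lin_morph (tens_lift_linear bil).
  (* The identity x_1 S(x_2) = counit(x) 1 expresses g S(x) through A and x; multiplying by S(g)
     then isolates S(x). *)
  have := antipode_sweedlerr x; rewrite /sweedler cx !mD !(tens_liftE bil) => e.
  have gSx : B (g * S x).
    rewrite -[g * S x](addKr (tens_lift (fun a b => a * S b) t + x * S h)) e.
    apply: (subspaceD sB); last exact: subspaceZ sB B1.
    apply: (subspaceN sB); apply: (subspaceD sB); last first.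
      by apply: BM => //; apply: AB; apply: SA.
    have [u uB ->] := At; rewrite (lin_sum _ _ (tens_lift_linear bil)).
    apply: (subspace_sum sB) => p /uB[Ap1 Ap2]; rewrite (tens_liftE bil).
    by apply: BM; apply: AB => //; apply: SA.
  have [Sg _] := grouplike_inv gg.
  rewrite -[S x]mul1r -Sg -mulrA; apply: BM => //.
  by apply: AB; apply: SA.
- by exists x; rewrite ?mem_head.
Qed.

Lemma hopf_subalgebra_affine : pointed H -> acc (@hopf_subalgebra k H) ->
  forall K, hopf_subalgebra K -> affine K.
Proof.
move=> ptd accH K hK; apply: contrapT => nK.
pose T := {A : set H | [/\ hopf_subalgebra A, affine A & A `<=` K]}.
have step (A : T) : exists B : T, sval A `<=` sval B /\ ~ sval B `<=` sval A.
  case: A => A [hA fA AK] /=.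
  have [|B [hB fB AB BK BA]] := affine_extend ptd hA fA hK AK.
    by move=> KA; apply: nK; rewrite (_ : K = A) // eqEsubset.
  by exists (exist _ B (And3 hB fB BK)).
have [nxt nxtP] := choice step.
(* The chain starts from the subalgebra generated by nothing, the scalars; iterating [nxt] makes
   every inclusion strict, against the chain condition. *)
have T0 : T.
  exists (gen [set` [::]]); split.
  - by apply: gen_hopf.
  - by exists [::].
  - by apply: gen_min => //; case: hK.
pose A n := sval (iter n nxt T0).
have [n|n|N stab] := accH A.
- by rewrite /A; case: (iter n nxt T0) => B [].
- by case: (nxtP (iter n nxt T0)).
have [_] := nxtP (iter N nxt T0).
by apply; rewrite -[sval (nxt _)]/(A N.+1) (stab N.+1 (leqnSn N)).
Qed.

End Affine.

Theorem corollary6p5 (k : fieldType) (H : hopfAlgType k) :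
  pointed H ->
  right_noetherian H \/ left_noetherian H ->
  (forall K : set H, hopf_subalgebra K -> affine K) /\
  acc (@hopf_subalgebra k H).
Proof.
move=> ptd noeth.
have accH : acc (@hopf_subalgebra k H).
  by case: noeth; [apply: right_noetherian_acc|apply: left_noetherian_acc].
by split=> //; apply: hopf_subalgebra_affine.
Qed.
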